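(* Let $\mathcal{H}=\{0,1,\dots,H-1\}$ with $H<\infty$ be a set of hypotheses and $\mathcal{A}=\{1,\dots,|\mathcal{A}|\}$ with $|\mathcal{A}|<\infty$ a set of actions, each action $a$ having a constant cost $c_a\in(0,\infty)$. An unknown state $\theta\in\mathcal{H}$ has uniform prior. At each time step $n=1,2,\dots$ a decision-maker chooses an action $A_n\in\mathcal{A}$, pays $c_{A_n}$, and observes a sample $X_n$ with density $f_\theta^{A_n}$; samples are conditionally independent given $\theta$ and the actions, and all densities $f_h^a$ are known. Assume: (A1) for every $a\in\mathcal{A}$ and $i,j\in\mathcal{H}$, $D(f_i^a\|f_j^a)$ is either $0$ or strictly positive; (A2) for all $i\neq j$ in $\mathcal{H}$ there is some $a\in\mathcal{A}$ with $D(f_i^a\|f_j^a)>0$, and there is no $a$ with $D(f_i^a\|f_j^a)=0$ for all $i,j\in\mathcal{H}$; (A3) there exists $\beta>0$ such that $\mathbb{E}_{X\sim f_i^a}\big[|\log(f_i^a(X)/f_j^a(X))|^2\big]<\beta$ for all $a\in\mathcal{A}$ and $i,j\in\mathcal{H}$. For each $h\in\mathcal{H}$ let $$\underline{\lambda}_h^*\in\arg\max_{\underline{\lambda}\in\Delta_{|\mathcal{A}|}}\frac{\min_{j\neq h}\mathbb{E}_{A\sim\underline{\lambda}}\big[D(f_h^A\|f_j^A)\big]}{\mathbb{E}_{A\sim\underline{\lambda}}[c_A]}.$$ Let $\underline{\rho}_n\in\Delta_H$ be the posterior over hypotheses, with $\underline{\rho}_0$ uniform and $\rho_n[i]=\rho_{n-1}[i]\,f_i^{a}(x)/\sum_{h\in\mathcal{H}}\rho_{n-1}[h]f_h^{a}(x)$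 when action $a=A_n$ is taken and $x=X_n$ is observed. Given $\delta\in(0,1)$, consider the policy that at each step draws $A_n\sim\underline{\lambda}^*_{h_n^*}$ (independently of everything else given $h_n^*$), where $h_n^*=\arg\max_{h\in\mathcal{H}}\rho_{n-1}[h]$ is the hypothesis with the currently largest posterior, stops at the first time $N$ at which some posterior component exceeds $1-\delta$, and declares $\hat\theta=\arg\max_h\rho_N[h]$. Then this policy satisfies $\mathbb{P}(\hat\theta\neq\theta)\le\delta$, and its expected total paid cost $\mathbb{E}\big[\sum_{n=1}^N c_{A_n}\big]$ is $\Theta(\log\frac{1}{\delta})$ as $\delta\to 0$.
   Context: $D(f\|g)$ is the Kullback–Leibler divergence; logarithms are base 2. $\Delta_n=\{\underline{x}\in\mathbb{R}^n:\underline{x}^T\underline{1}=1,\ \underline{x}\ge\underline{0}\}$ is the probability simplex, and for $\underline{\lambda}\in\Delta_{|\mathcal{A}|}$, $A\sim\underline{\lambda}$ means $\mathbb{P}(A=a)=\lambda[a]$. $\Theta(\cdot)$ is the Bachmann–Landau notation. The expectation and probability are over $\theta$ (uniform), the samples, and the randomized actions. *)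

(* Defs.v *)
From HB Require Import structures.
From mathcomp Require Import all_boot all_order all_algebra.
From mathcomp Require Import all_classical all_reals all_analysis.
Set Implicit Arguments. Unset Strict Implicit. Unset Printing Implicit Defensive.
Import Order.TTheory GRing.Theory Num.Theory.
Local Open Scope ring_scope.
Local Open Scope ereal_scope.

Section ActiveTesting.
Context {R : realType} {d : measure_display} {X : measurableType d}.
Variables (H A : nat) (mu : {measure set X -> \bar R})
          (f : 'I_A -> 'I_H -> X -> R).

Definition log2 (x : R) : R := (ln x / ln 2)%R.

Definition KL (a : 'I_A) (i j : 'I_H) : \bar R :=
  \int[mu]_x (if f a i x == 0%R then 0
              else if f a j x == 0%R then +oo
              else (f a i x * log2 (f a i x / f a j x))%:E).

Definition llr_sq_moment (a : 'I_A) (i j : 'I_H) : \bar R :=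
  \int[mu]_x ((f a i x)%:E *
     (if f a j x == 0%R then +oo else ((log2 (f a i x / f a j x)) ^+ 2)%:E)).

Definition in_simplex (l : 'I_A -> R) : Prop :=
  (forall a, 0 <= l a)%R /\ (\sum_(a < A) l a = 1)%R.

Definition objective (c : 'I_A -> R) (h : 'I_H) (l : 'I_A -> R) : \bar R :=
  (\big[mine/+oo]_(j < H | j != h) (\sum_(a < A) (l a)%:E * KL a h j))
  * ((\sum_(a < A) l a * c a)^-1)%:E.

Definition update (rho : 'I_H -> R) (a : 'I_A) (x : X) : 'I_H -> R :=
  fun i => (rho i * f a i x / \sum_(h < H) rho h * f a h x)%R.

Definition uniform_prior : 'I_H -> R := fun _ => (H%:R)^-1%R.

Definition stopped (delta : R) (rho : 'I_H -> R) : bool :=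
  [exists i, (1 - delta < rho i)%R].

Variables (amax : ('I_H -> R) -> 'I_H) (lam : 'I_H -> 'I_A -> R)
          (c : 'I_A -> R) (delta : R) (theta : 'I_H).

(** Probability, starting from posterior rho (true state theta), that the
    policy stops within n further steps and declares the correct hypothesis. *)
Fixpoint correct_within (n : nat) (rho : 'I_H -> R) {struct n} : \bar R :=
  if stopped delta rho then (amax rho == theta)%:R%:E
  else match n with
       | 0 => 0
       | n'.+1 => \sum_(a < A) (lam (amax rho) a)%:E *
           \int[mu]_x ((f a theta x)%:E * correct_within n' (update rho a x))
       end.

(** Expected cost paid during the first n steps (i.e. E[sum_{k <= min(N,n)} c_{A_k}])
    starting from posterior rho, true state theta. *)
Fixpoint cost_within (n : nat) (rho : 'I_H -> R) {struct n} : \bar R :=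
  if stopped delta rho then 0
  else match n with
       | 0 => 0
       | n'.+1 => \sum_(a < A) (lam (amax rho) a)%:E *
           ((c a)%:E +
            \int[mu]_x ((f a theta x)%:E * cost_within n' (update rho a x)))
       end.

End ActiveTesting.

Section Policy.
Context {R : realType} {d : measure_display} {X : measurableType d}.
Variables (H A : nat) (mu : {measure set X -> \bar R})
          (f : 'I_A -> 'I_H -> X -> R)
          (amax : ('I_H -> R) -> 'I_H) (lam : 'I_H -> 'I_A -> R)
          (c : 'I_A -> R) (delta : R).

(** P(theta_hat <> theta) with theta uniform; never stopping counts as an error. *)
Definition error_prob : \bar R :=
  1 - ereal_sup (range (fun n => \sum_(t < H) ((H%:R)^-1)%:E *
        correct_within mu f amax lam delta t n (@uniform_prior R H))).

Definition expected_cost : \bar R :=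
  ereal_sup (range (fun n => \sum_(t < H) ((H%:R)^-1)%:E *
        cost_within mu f amax lam c delta t n (@uniform_prior R H))).

End Policy.

(* Main.v *)
Require Import Defs.
From HB Require Import structures.
From mathcomp Require Import all_boot all_order all_algebra.
From mathcomp Require Import all_classical all_reals all_analysis.
From mathcomp Require Import measurable_realfun ring lra.
Import Order.TTheory GRing.Theory Num.Theory.
Local Open Scope ring_scope.
Local Open Scope ereal_scope.

(* All the control comes from two potentials of the posterior [rho] under a true
   state [t]: [root_odds], the sum of [sqrt (rho j / rho t)], and [log_odds], the
   sum of [`|log2 (rho t / rho j)|], over [j != t].
   The expectation of [sqrt (rho j / rho t)] is multiplied at each step by the
   Hellinger affinity of the two densities, which is [< 1] when the action
   separates [t] from [j].  Optimality of [lam h] makes it separate [h] from every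
   [j]; hence if the leading hypothesis is [t] all terms contract, and otherwise
   the term of the leader, the largest one, does.  So [root_odds] contracts
   geometrically whatever the leader is, while it is at least [sqrt delta] before
   stopping: the stopping time has an exponential tail and its mean is
   [O (log (1 / delta))], and the error probability is controlled by the posterior
   at the stopping time.
   Conversely, by the second moment assumption [log_odds] grows by a bounded amount
   per step in expectation, and has to reach about [log2 (1 / delta)]. *)

(** * Integrals of nonnegative functions as suprema over simple functions *)

Section Integrals.
Context {d : measure_display} {T : measurableType d} {R : realType}.
Context (mu : {measure set T -> \bar R}).
Import HBNNSimple.
Implicit Types F G : T -> \bar R.

(** Every simple function below [F] is below [G], so the supremum defining the integral grows
    without any measurability of the integrands. *)
Lemma ge0_le_integral_nomeas F G : (forall x, 0 <= F x) ->
  (forall x, F x <= G x) -> \int[mu]_x F x <= \int[mu]_x G x.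
Proof.
move=> F0 FG; have G0 x : 0 <= G x by exact: le_trans (F0 x) (FG x).
rewrite !ge0_integralTE//; apply: ge_ereal_sup => _ [h /= hF <-].
by apply: ereal_sup_ubound; exists h => //= x; exact: le_trans (hF x) (FG x).
Qed.

(** The nonzero level sets of a simple function below [F] lie inside [D], where the restricted
    measure and [mu] agree. *)
Lemma integral_mrestr_support (D : set T) (mD : measurable D) F :
  (forall x, 0 <= F x) -> (forall x, ~ D x -> F x = 0) ->
  \int[mrestr mu mD]_x F x = \int[mu]_x F x.
Proof.
move=> F0 FD; rewrite !ge0_integralTE//; congr ereal_sup.
suff sE (h : {nnsfun T >-> R}) : (forall x, (h x)%:E <= F x) ->
    sintegral (mrestr mu mD) h = sintegral mu h.
  by apply/seteqP; split=> _ [h hF <-]; exists h => //; rewrite sE.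
move=> hF; rewrite /sintegral; apply: eq_fsbigr => r _.
have [->|r0] := eqVneq r 0%R; first by rewrite !mul0e.
congr (_ * _); rewrite /mrestr; congr (mu _); apply/seteqP; split=> [x []//|x /= hx].
split=> //; apply: contrapT => /FD Fx; case/negP: r0; rewrite eq_le.
have := hF x; rewrite Fx lee_fin hx => -> /=.
by rewrite -hx.
Qed.

End Integrals.

(** * Measurability of integrals against a density, in a parameter *)

Section ParameterIntegral.
Context {d d' : measure_display} {T : measurableType d} {Y : measurableType d'}.
Context {R : realType} (mu : {measure set T -> \bar R}) (p : T -> R).
Hypotheses (mp : measurable_fun setT p) (p0 : forall x, (0 <= p x)%R).
Hypothesis p_fin : \int[mu]_x (p x)%:E < +oo.

Let D : set T := [set x | 0 < p x]%R%classic.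

Let mD : measurable D.
Proof.
have mb : measurable_fun setT (fun x => 0 < p x)%R by exact: measurable_fun_ltr.
by rewrite -[D]setTI; exact: (mb measurableT [set true]%classic).
Qed.

Let sigma_finite_support : sigma_finite setT (mrestr mu mD).
Proof.
(* The complement of [D] is null for the restricted measure, and the superlevel sets of [p] have
   finite measure by Markov's inequality. *)
exists (fun n => ~` D `|` [set x | (n.+1%:R^-1 <= p x)%R])%classic.
  apply/esym/seteqP; split=> // x _.
  have [Dx|Dx] := pselect (D x); last by exists 0%N => //; left.
  exists (Num.truncn (p x)^-1) => //; right => /=.
  rewrite invf_ple ?posrE//; apply: ltW.
  exact: (real_truncnS_gt (num_real _)).
move=> n; have mE : measurable [set x | (n.+1%:R^-1 <= p x)%R]%classic.
  have mb : measurable_fun setT (fun x => n.+1%:R^-1 <= p x)%R.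
    exact: measurable_fun_ler.
  by rewrite -[X in measurable X]setTI; exact: (mb measurableT [set true]%classic).
split; first by apply: measurableU => //; exact: measurableC.
have := le_integral_abse mu measurableT (a := (n.+1%:R^-1 : R)%R)
  (proj2 (measurable_EFinP _ _) mp).
rewrite setTI invr_gt0 ltr0n => /(_ isT).
have -> : \int[mu]_x `|(EFin \o p) x| = \int[mu]_x (p x)%:E.
  by apply: eq_integral => x _; rewrite /= ger0_norm.
move=> /le_lt_trans/(_ p_fin) fin.
apply: (@le_lt_trans _ _ (mu [set x | (n.+1%:R^-1%:E <= `|(p x)%:E|)]%classic)).
  rewrite /mrestr; apply: le_measure; rewrite ?inE.
  - by apply: measurableI => //; apply: measurableU => //; exact: measurableC.
  - rewrite (_ : [set x | _] = [set x | (n.+1%:R^-1 <= p x)%R])%classic//.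
    by apply/seteqP; split=> x /=; rewrite ger0_norm ?lee_fin.
  - by move=> x [[]// /= px _]; rewrite ger0_norm ?lee_fin.
move: fin; case: (mu _) => [r _||]//; first exact: ltry.
by rewrite gt0_muley ?lte_fin ?invr_gt0.
Qed.

(* [mu] need not be sigma-finite, but its restriction to the support of the
   integrable [p] is, so that Tonelli's theorem applies to that restriction. *)
Lemma measurable_fun_integral_density (g : Y * T -> \bar R) :
  measurable_fun setT g -> (forall z, 0 <= g z) ->
  measurable_fun setT (fun y => \int[mu]_x ((p x)%:E * g (y, x))).
Proof.
move=> mg g0.
pose S := @Measure_isSigmaFinite.Build _ _ _ (mrestr mu mD) sigma_finite_support.
pose m : {sigma_finite_measure set T -> \bar R} := HB.pack (mrestr mu mD) S.
have -> : (fun y => \int[mu]_x ((p x)%:E * g (y, x))) =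
    fubini_F m (fun z => (p z.2)%:E * g z).
  apply/funext => y; rewrite /fubini_F/= -(@integral_mrestr_support _ _ _ mu D mD)//.
    by move=> x; rewrite mule_ge0// lee_fin.
  move=> x Dx; have /eqP -> : p x == 0%R; last by rewrite mul0e.
  by rewrite eq_le p0 andbT leNgt; exact/negP.
apply: measurable_fun_fubini_tonelli_F => [|z]; last by rewrite mule_ge0// lee_fin.
apply: emeasurable_funM => //; apply/measurable_EFinP.
exact: measurableT_comp mp measurable_snd.
Qed.

End ParameterIntegral.

(** * Affinity and log-likelihood ratios *)

Section Densities.
Context {R : realType} {d : measure_display} {X : measurableType d}.
Context (mu : {measure set X -> \bar R}).

(** The Bhattacharyya coefficient. For probability densities the integral is finite, so [fine] loses
    nothing. *)
Definition affinity (p q : X -> R) : R := fine (\int[mu]_x (Num.sqrt (p x * q x))%:E).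

Context (p q : X -> R).
Hypotheses (mp : measurable_fun setT p) (mq : measurable_fun setT q).
Hypotheses (p0 : forall x, (0 <= p x)%R) (q0 : forall x, (0 <= q x)%R).
Hypotheses (p1 : \int[mu]_x (p x)%:E = 1) (q1 : \int[mu]_x (q x)%:E = 1).

Let measurable_sqrt (g : X -> R) : measurable_fun setT g ->
  measurable_fun setT (fun x => Num.sqrt (g x)).
Proof.
move=> mg; apply: measurableT_comp mg.
by apply: continuous_measurable_fun; exact: sqrt_continuous.
Qed.

Lemma measurable_sqrt_mul : measurable_fun setT (fun x => Num.sqrt (p x * q x)).
Proof. by apply: measurable_sqrt; exact: measurable_funM. Qed.

Let D : \bar R := \int[mu]_x (((Num.sqrt (p x) - Num.sqrt (q x)) ^+ 2)%R)%:E.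

Let mD : measurable_fun setT (fun x => ((Num.sqrt (p x) - Num.sqrt (q x)) ^+ 2)%R).
Proof. by apply: measurable_funX; apply: measurable_funB; exact: measurable_sqrt. Qed.

(** Expanding the square gives [p + q] pointwise. Stated as a sum in the extended reals, the
    identity yields both the finiteness of the affinity and its bound by 1. *)
Let hellinger_affinity : D + 2%:E * \int[mu]_x (Num.sqrt (p x * q x))%:E = 2%:E.
Proof.
rewrite -ge0_integralZl_EFin//; last first.
  by apply/measurable_EFinP; exact: measurable_sqrt_mul.
rewrite /D -ge0_integralD; [|by []|by move=> x _; rewrite lee_fin sqr_ge0
  |exact/measurable_EFinP|by move=> x _; rewrite -EFinM lee_fin mulr_ge0|]; last first.
  by apply/measurable_EFinP; apply: measurable_funM => //; exact: measurable_sqrt_mul.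
transitivity (\int[mu]_x ((p x)%:E + (q x)%:E)).
  apply: eq_integral => x _; rewrite -EFinM -!EFinD; congr EFin.
  by rewrite sqrrB !sqr_sqrtr// sqrtrM//; ring.
rewrite ge0_integralD; [|by []|by move=> x _; rewrite lee_fin|exact/measurable_EFinP
  |by move=> x _; rewrite lee_fin|exact/measurable_EFinP].
by rewrite p1 q1 -EFinD; congr EFin; ring.
Qed.

Let D0 : 0 <= D.
Proof. by apply: integral_ge0 => x _; rewrite lee_fin sqr_ge0. Qed.

Lemma integral_sqrt_mul : \int[mu]_x (Num.sqrt (p x * q x))%:E = (affinity p q)%:E.
Proof.
rewrite /affinity fineK// ge0_fin_numE; last first.
  by apply: integral_ge0 => x _; rewrite lee_fin.
move: hellinger_affinity D0; set I := \int[mu]_x _.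
have : 0 <= I by apply: integral_ge0 => x _; rewrite lee_fin.
case: I => [r||]// _; first by rewrite ltry.
by rewrite gt0_muley ?lte_fin//; case: D.
Qed.

Lemma affinity_ge0 : (0 <= affinity p q)%R.
Proof.
by rewrite -lee_fin -integral_sqrt_mul; apply: integral_ge0 => x _; rewrite lee_fin.
Qed.

Lemma affinity_le1 : (affinity p q <= 1)%R.
Proof.
move: hellinger_affinity D0; rewrite integral_sqrt_mul.
case: D => [r||]//; rewrite -EFinM -EFinD => -[] e; rewrite lee_fin; lra.
Qed.

Lemma affinity_eq1 : affinity p q = 1%R -> {ae mu, forall x, p x = q x}.
Proof.
move=> a1; have : D = 0.
  move: hellinger_affinity; rewrite integral_sqrt_mul a1.
  by case: D => [r||]//; rewrite -EFinM -EFinD => -[] e; congr EFin; lra.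
rewrite /D => D00.
have /ae_eq_integral_abs : \int[mu]_x `|(((Num.sqrt (p x) - Num.sqrt (q x)) ^+ 2)%R)%:E| = 0.
  rewrite -D00; apply: eq_integral => x _.
  by rewrite gee0_abs// lee_fin sqr_ge0.
move=> /(_ measurableT) []; first exact/measurable_EFinP.
move=> N [mN N0 NP]; exists N; split => // x /= npq; apply: NP => /= /(_ I) -[] /eqP.
rewrite sqrf_eq0 subr_eq0 => /eqP e; apply: npq.
by rewrite -(sqr_sqrtr (p0 x)) e sqr_sqrtr.
Qed.

End Densities.

(** * Consequences of the moment assumption for the densities *)

Section Model.
Context {R : realType} {d : measure_display} {X : measurableType d}.
Context {H A : nat} {mu : {measure set X -> \bar R}} {f : 'I_A -> 'I_H -> X -> R}.
Hypotheses (mf : forall a h, measurable_fun setT (f a h)).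
Hypotheses (f0 : forall a h x, (0 <= f a h x)%R).

Let measurable_f_eq0 a h : measurable_fun setT (fun x => f a h x == 0%R).
Proof. by apply: measurable_fun_eqr => //; exact: measurable_cst. Qed.

Lemma measurable_log_ratio a i j :
  measurable_fun setT (fun x => log2 (f a i x / f a j x)).
Proof.
(* The conventions [0^-1 = 0] and [ln 0 = 0] make the logarithm of the ratio vanish as soon as one
   of the densities does. *)
have -> : (fun x => log2 (f a i x / f a j x)) = (fun x =>
    if (f a i x == 0%R) || (f a j x == 0%R) then 0%R
    else ((ln (f a i x) - ln (f a j x)) / ln 2)%R).
  apply/funext => x; rewrite /log2.
  have [->|fi] := eqVneq (f a i x) 0%R; first by rewrite mul0r ln0// mul0r.
  have [->|fj] := eqVneq (f a j x) 0%R; first by rewrite invr0 mulr0 ln0// mul0r.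
  by rewrite ln_div// posrE lt_neqAle eq_sym ?fi ?fj f0.
apply: measurable_fun_ifT => //; first exact: measurable_or.
apply: measurable_funM => //.
by apply: measurable_funB; exact: (measurableT_comp (@measurable_ln R)).
Qed.

(** Used in contrapositive form: a positive divergence excludes almost everywhere equality, hence an
    affinity equal to 1. *)
Lemma KL_eq0 a i j : {ae mu, forall x, f a i x = f a j x} -> KL mu f a i j = 0.
Proof.
move=> [N [mN N0 NP]]; rewrite /KL.
transitivity (\int[mu]_x cst 0 x); last exact: integral0.
apply: ae_eq_integral => //.
- apply: measurable_fun_ifT => //; apply: measurable_fun_ifT => //.
  apply/measurable_EFinP; apply: measurable_funM => //.
  exact: measurable_log_ratio.
- exists N; split => // x /= /not_implyP[_ nE]; apply: NP => /= E; apply: nE.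
  rewrite -E; case: ifPn => // fi0.
  by rewrite (negbTE fi0) divff// /log2 ln1 mul0r mulr0.
Qed.

(** On the set where [f a i] is positive and [f a j] vanishes, the integrand of the second moment is
    [+oo]. A finite moment forces this set to be null, and there are finitely many pairs. *)
Lemma ae_common_support a : (forall i j, llr_sq_moment mu f a i j < +oo) ->
  {ae mu, forall x, (forall h, f a h x = 0%R) \/ (forall h, (0 < f a h x)%R)}.
Proof.
move=> fin.
have aeij i j : {ae mu, forall x, f a j x = 0%R -> f a i x = 0%R}.
  pose N := [set x | (f a i x != 0%R) && (f a j x == 0%R)]%classic.
  have mN : measurable N.
    have mb : measurable_fun setT (fun x => (f a i x != 0%R) && (f a j x == 0%R)).
      apply: measurable_and; [exact: measurable_neg|].
      exact: measurable_f_eq0.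
    rewrite -[N]setTI. exact: (mb measurableT [set true]%classic).
  exists N; split => // [|x /= /not_implyP[fj fi]]; last first.
    by rewrite /N/= fj eqxx andbT; exact/eqP.
  apply/eqP; rewrite eq_le measure_ge0 andbT leNgt; apply/negP => muN.
  suff : +oo <= llr_sq_moment mu f a i j by rewrite leNgt fin.
  rewrite -(gt0_mulye muN) -integral_cst// integral_mkcond.
  apply: ge0_le_integral_nomeas => x.
    by rewrite patchE; case: ifP => _; rewrite ?leey.
  rewrite patchE; case: ifPn => [|_].
    rewrite inE /N/= => /andP[fi fj]; rewrite fj gt0_muley//.
    by rewrite lte_fin lt_neqAle eq_sym fi f0.
  apply: mule_ge0; first by rewrite lee_fin.
  by case: ifP => // _; rewrite lee_fin sqr_ge0.
have : {ae mu, forall x, forall i j, f a j x = 0%R -> f a i x = 0%R}.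
  by apply: filter_forall => i; apply: filter_forall => j; exact: aeij.
apply: filterS => x E.
have [/existsP[h /eqP fh]|/existsPn ne] := boolP [exists h, f a h x == 0%R].
  by left=> i; exact: E fh.
by right=> h; rewrite lt_neqAle eq_sym ne f0.
Qed.

Lemma integral_abs_log_ratio a i j (b : R) :
  \int[mu]_x (f a i x)%:E = 1 -> llr_sq_moment mu f a i j < b%:E ->
  \int[mu]_x (f a i x * `|log2 (f a i x / f a j x)|)%:E <= (1 + b)%:E.
Proof.
move=> f1 lb.
have msq : measurable_fun setT (fun x => f a i x * log2 (f a i x / f a j x) ^+ 2)%R.
  apply: measurable_funM => //; apply: measurable_funX.
  exact: measurable_log_ratio.
apply: (@le_trans _ _ (\int[mu]_x ((f a i x)%:E +
    (f a i x * log2 (f a i x / f a j x) ^+ 2)%:E))).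
  apply: ge0_le_integral_nomeas => x; first by rewrite lee_fin mulr_ge0.
  rewrite -EFinD lee_fin -[X in (X + _)%R]mulr1 -mulrDr ler_wpM2l//.
  (* This is [|y| <= 1 + y ^ 2]. *)
  set y := log2 _; rewrite -real_normK ?num_real//; nra.
rewrite ge0_integralD; [|by []|by move=> x _; rewrite lee_fin|exact/measurable_EFinP
  |by move=> x _; rewrite lee_fin mulr_ge0// sqr_ge0|exact/measurable_EFinP].
rewrite f1 EFinD leeD2l//; apply: le_trans (ltW lb).
apply: ge0_le_integral_nomeas => x; first by rewrite lee_fin mulr_ge0// sqr_ge0.
(* Where [f a j] vanishes the real-valued logarithm is 0 by convention, which is below the [+oo] of
   the definition. *)
case: ifPn => [/eqP fj|_]; last by rewrite EFinM.
rewrite fj invr0 mulr0 /log2 ln0// mul0r expr0n mulr0.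
by rewrite mule_ge0// lee_fin.
Qed.

End Model.

(** * Posteriors and their potentials *)

Section Beliefs.
Context {R : realType} {H : nat}.
Implicit Types (rho : 'I_H -> R) (t : 'I_H).
Local Open Scope ring_scope.

(** Strict positivity keeps all posterior ratios meaningful. It holds for the uniform prior and
    survives an update at any point where all densities are positive. *)
Definition belief rho : Prop := (forall i, 0 < rho i) /\ \sum_i rho i = 1.

Definition root_odds t rho : R := \sum_(j < H | j != t) Num.sqrt (rho j / rho t).

Definition log_odds t rho : R := \sum_(j < H | j != t) `|log2 (rho t / rho j)|.

Lemma root_odds_ge0 t rho : 0 <= root_odds t rho.
Proof. by apply: sumr_ge0 => j _. Qed.

Lemma log_odds_ge0 t rho : 0 <= log_odds t rho.
Proof. by apply: sumr_ge0 => j _. Qed.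

Lemma ln2_gt0 : 0 < ln (2 : R).
Proof. by rewrite ln_gt0 ?ltr1n. Qed.

Lemma log2M (x y : R) : 0 < x -> 0 < y -> log2 (x * y) = log2 x + log2 y.
Proof. by move=> x0 y0; rewrite /log2 lnM ?posrE// mulrDl. Qed.

Lemma log2V (x : R) : 0 < x -> log2 x^-1 = - log2 x.
Proof. by move=> x0; rewrite /log2 lnV ?posrE// mulNr. Qed.

Lemma ler_log2 (x y : R) : 0 < x -> x <= y -> log2 x <= log2 y.
Proof.
move=> x0 xy; rewrite /log2 ler_pM2r ?invr_gt0 ?ln2_gt0//.
by rewrite ler_ln ?posrE// (lt_le_trans x0).
Qed.

Lemma belief_sumB rho t : belief rho -> \sum_(j < H | j != t) rho j = 1 - rho t.
Proof. by move=> [_ <-]; rewrite [in RHS](bigD1 t)//= [in RHS]addrC addrK. Qed.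

Lemma belief_leB rho t j : belief rho -> j != t -> rho j <= 1 - rho t.
Proof.
move=> b jt; rewrite -belief_sumB// (bigD1 j)//= lerDl.
by apply: sumr_ge0 => i _; apply: ltW; exact: b.1.
Qed.

Lemma belief_le1 rho t : belief rho -> rho t <= 1.
Proof.
move=> b; rewrite -subr_ge0 -belief_sumB//.
by apply: sumr_ge0 => i _; apply: ltW; exact: b.1.
Qed.

(** The square of a sum of nonnegative terms dominates the sum of their squares, here
    [(1 - rho t) / rho t], which is at least [delta] since [rho t <= 1 - delta]. *)
Lemma sqrt_delta_le_root_odds (delta : R) t rho : 0 < delta -> belief rho ->
  ~~ stopped delta rho -> Num.sqrt delta <= root_odds t rho.
Proof.
move=> d0 b /existsPn /(_ t); rewrite -leNgt => rt.
have rt0 := b.1 t; set S := root_odds t rho.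
have S0 : 0 <= S by exact: root_odds_ge0.
rewrite -(ger0_norm S0) -sqrtr_sqr ler_wsqrtr//.
have le_sqrt j : j != t -> Num.sqrt (rho j / rho t) <= S.
  by move=> jt; rewrite /S /root_odds (bigD1 j)//= lerDl sumr_ge0.
have : \sum_(j < H | j != t) rho j / rho t <= S ^+ 2.
  rewrite expr2 {2}/S /root_odds mulr_sumr; apply: ler_sum => j jt.
  rewrite -[leLHS]sqr_sqrtr ?divr_ge0 ?(ltW (b.1 _))// expr2.
  by apply: ler_wpM2r => //; exact: le_sqrt.
apply: le_trans; rewrite -mulr_suml belief_sumB//.
rewrite ler_pdivlMr//; have := belief_le1 rho t b; nra.
Qed.

(** Once [rho i > 1 - delta], every other component is below [delta], so each ratio involving [i] is
    extreme. If [i = t], a second hypothesis [t'] supplies the term; otherwise the term of [i]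
    does. *)
Lemma log_odds_ge_of_stopped (delta : R) t t' rho : 0 < delta < 1 -> t' != t ->
  belief rho -> stopped delta rho -> log2 ((1 - delta) / delta) <= log_odds t rho.
Proof.
move=> /andP[d0 d1] t't b /existsP[i ri].
have key j k : j != k -> 1 - delta < rho j ->
    log2 ((1 - delta) / delta) <= `|log2 (rho j / rho k)|.
  move=> jk rj; apply: le_trans (ler_norm _); apply: ler_log2.
    by rewrite divr_gt0// subr_gt0.
  apply: ler_pM => //; first by rewrite subr_ge0 ltW.
  - by rewrite invr_ge0 ltW.
  - exact: ltW.
  - rewrite lef_pV2 ?posrE// ?b.1//.
    have := belief_leB rho j k b; rewrite eq_sym => /(_ jk); lra.
have term j : j != t -> `|log2 (rho t / rho j)| <= log_odds t rho.
  by move=> jt; rewrite /log_odds (bigD1 j)//= lerDl sumr_ge0.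
have [it|it] := eqVneq i t.
  apply: (le_trans _ (term t' t't)); rewrite -it in t't *.
  by apply: key => //; rewrite eq_sym.
apply: (le_trans (key _ _ it ri)); apply: (le_trans _ (term i it)).
have := b.1 i; have := b.1 t => rt0 ri0.
by rewrite -(invf_div (rho t)) log2V ?divr_gt0// normrN.
Qed.

Lemma belief_uniform : (0 < H)%N -> belief (@uniform_prior R H).
Proof.
move=> H0; rewrite /belief /uniform_prior; split=> [i|].
  by rewrite invr_gt0 ltr0n.
by rewrite sumr_const card_ord -[LHS]mulr_natl divff// pnatr_eq0 -lt0n.
Qed.

Lemma root_odds_uniform t : root_odds t (@uniform_prior R H) <= H%:R.
Proof.
have H0 : (H%:R^-1 : R) != 0.
  by rewrite invr_eq0 pnatr_eq0 -lt0n (leq_ltn_trans _ (ltn_ord t)).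
rewrite /root_odds /uniform_prior divff// sqrtr1.
apply: (@le_trans _ _ (\sum_(j < H) 1)); last by rewrite sumr_const card_ord.
by rewrite [leRHS](bigD1 t)//= lerDr.
Qed.

Lemma log_odds_uniform t : log_odds t (@uniform_prior R H) = 0.
Proof.
rewrite /log_odds /uniform_prior; apply: big1 => j _.
rewrite divff ?/log2 ?ln1 ?mul0r ?normr0//.
by rewrite invr_eq0 pnatr_eq0 -lt0n (leq_ltn_trans _ (ltn_ord t)).
Qed.

(** * Effect of one Bayes update on the potentials *)

Section Update.
Context {d : measure_display} {X : measurableType d} {A : nat}.
Context (f : 'I_A -> 'I_H -> X -> R) (a : 'I_A) (x : X) (rho : 'I_H -> R).
Hypotheses (fx : forall h, 0 < f a h x) (b : belief rho).

Lemma evidence_gt0 : 0 < \sum_(h < H) rho h * f a h x.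
Proof.
have r0 h : 0 < rho h * f a h x by rewrite mulr_gt0// b.1.
rewrite lt_neqAle sumr_ge0 ?andbT; last by move=> h _; exact: ltW.
apply/eqP => /esym /eqP; rewrite psumr_eq0; last by move=> h _; exact: ltW.
move=> /allP z; have := b.2; rewrite big1 => [/eqP|h _]; first by rewrite eq_sym oner_eq0.
by have := z h (mem_index_enum h); rewrite /= gt_eqF.
Qed.

Lemma belief_update : belief (update f rho a x).
Proof.
have s0 := evidence_gt0; split=> [i|]; rewrite /update.
  by rewrite divr_gt0// mulr_gt0// b.1.
by rewrite -mulr_suml divff// gt_eqF.
Qed.

(** The evidence cancels; this is why both potentials depend on ratios only. *)
Lemma update_ratio i j :
  update f rho a x i / update f rho a x j = (rho i / rho j) * (f a i x / f a j x).
Proof.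
have s0 := evidence_gt0; rewrite /update.
have := b.1 i; have := b.1 j; have := fx i; have := fx j => *.
by field; rewrite !gt_eqF.
Qed.

(** Weighting by the true density turns each [sqrt (f a j x / f a t x)] into the integrand of an
    affinity. *)
Lemma root_odds_update t : f a t x * root_odds t (update f rho a x) =
  \sum_(j < H | j != t) Num.sqrt (rho j / rho t) * Num.sqrt (f a t x * f a j x).
Proof.
rewrite /root_odds mulr_sumr; apply: eq_bigr => j jt.
rewrite update_ratio sqrtrM ?divr_ge0 ?(ltW (b.1 _))// mulrCA; congr (_ * _).
have ft := fx t; rewrite -{1}(ger0_norm (ltW ft)) -sqrtr_sqr -sqrtrM ?sqr_ge0//.
by congr Num.sqrt; field; rewrite gt_eqF.
Qed.

Lemma log_odds_update t : log_odds t (update f rho a x) <=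
  log_odds t rho + \sum_(j < H | j != t) `|log2 (f a t x / f a j x)|.
Proof.
rewrite /log_odds -big_split; apply: ler_sum => j _ /=.
rewrite update_ratio log2M; [exact: ler_normD| |].
  by rewrite divr_gt0// b.1.
by rewrite divr_gt0.
Qed.

End Update.
End Beliefs.

(** * Contraction under the optimal actions *)

Section Policy.
Context {R : realType} {d : measure_display} {X : measurableType d}.
Context {H A : nat} {mu : {measure set X -> \bar R}} {f : 'I_A -> 'I_H -> X -> R}.
Context {c : 'I_A -> R} {lam : 'I_H -> 'I_A -> R}.
Hypotheses (mf : forall a h, measurable_fun setT (f a h)).
Hypotheses (f0 : forall a h x, (0 <= f a h x)%R).
Hypotheses (f1 : forall a h, \int[mu]_x (f a h x)%:E = 1).
Hypothesis c0 : forall a, (0 < c a)%R.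
Hypothesis lam_simplex : forall h, in_simplex (lam h).

Let aff a i j := affinity mu (f a i) (f a j).

Lemma affinityC a i j : aff a i j = aff a j i.
Proof. by rewrite /aff /affinity; under eq_integral do rewrite mulrC. Qed.

Lemma aff_le1 a i j : (aff a i j <= 1)%R.
Proof. exact: affinity_le1. Qed.

Lemma aff_lt1 a i j : 0 < KL mu f a i j -> (aff a i j < 1)%R.
Proof.
move=> kl; rewrite lt_neqAle aff_le1 andbT; apply/eqP => a1.
by move: kl; rewrite KL_eq0 ?ltxx//; exact: affinity_eq1.
Qed.

Section Separation.
Hypothesis KL0 : forall a i j, 0 <= KL mu f a i j.
Hypothesis distinguishable : forall i j : 'I_H, i != j -> exists a, 0 < KL mu f a i j.
Hypothesis optimal : forall h l, in_simplex l ->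
  objective mu f c h l <= objective mu f c h (lam h).

Lemma actions_gt0 (h : 'I_H) : (0 < A)%N.
Proof.
rewrite lt0n; apply/eqP => A0; have [_] := lam_simplex h.
rewrite big1 => [/eqP|a _]; first by rewrite eq_sym oner_eq0.
by have aA := ltn_ord a; have := leq_ltn_trans (leq0n _) aA; rewrite [X in (_ < X)%N]A0.
Qed.

(** The uniform mixture gives weight to an action separating [h] from each [j], so the optimal value
    is positive too. *)
Lemma objective_uniform_gt0 h : 0 < objective mu f c h (fun=> (A%:R)^-1%R).
Proof.
have A0 := actions_gt0 h.
have u0 : (0 < (A%:R)^-1 :> R)%R by rewrite invr_gt0 ltr0n.
apply: mule_gt0.
  apply: lt_bigmin => [|j jh]; first exact: ltey.
  have [a kl] : exists a, 0 < KL mu f a h j.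
    by apply: distinguishable; rewrite eq_sym.
  rewrite (bigD1 a)//=; apply: (@lt_le_trans _ _ ((A%:R^-1)%:E * KL mu f a h j)).
    by rewrite mule_gt0// lte_fin.
  by rewrite leeDl// sume_ge0// => b _; rewrite mule_ge0// lee_fin ltW.
rewrite lte_fin invr_gt0 (bigD1 (Ordinal A0))//= ltr_pwDl ?mulr_gt0//.
by rewrite sumr_ge0// => b _; rewrite mulr_ge0 ?ltW.
Qed.

(** Otherwise the entry of [j] in the minimum would be 0 and the optimal objective nonpositive. *)
Lemma optimal_informative h j : j != h ->
  exists a, (0 < lam h a)%R /\ 0 < KL mu f a h j.
Proof.
move=> jh; apply: contrapT => /forallNP no.
have uS : in_simplex (fun _ : 'I_A => (A%:R)^-1%R : R).
  split=> [a|]; first by rewrite invr_ge0 ler0n.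
  by rewrite sumr_const card_ord -[LHS]mulr_natl divff// pnatr_eq0 -lt0n (actions_gt0 h).
have := lt_le_trans (objective_uniform_gt0 h) (optimal h _ uS).
apply/negP; rewrite -leNgt; apply: mule_le0_ge0; last first.
  rewrite lee_fin invr_ge0 sumr_ge0// => a _; rewrite mulr_ge0//; last exact: ltW.
  exact: (lam_simplex h).1.
apply: (le_trans (@bigmin_le_cond _ _ _ +oo j (fun j => j != h)
  (fun j => \sum_(a < A) (lam h a)%:E * KL mu f a h j) jh)); rewrite big1// => a _.
have := (lam_simplex h).1 a; rewrite le_eqVlt => /predU1P[<-|la]; first by rewrite mul0e.
have := KL0 a h j; rewrite le_eqVlt => /predU1P[<-|kl]; first by rewrite mule0.
by have := no a; case.
Qed.

Lemma exists_separation : exists2 eps : R, (0 < eps <= 1)%R & forall h j, j != h ->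
  (\sum_(a < A) lam h a * aff a h j <= 1 - eps)%R.
Proof.
pose e (p : 'I_H * 'I_H) := (1 - \sum_(a < A) lam p.1 a * aff a p.1 p.2)%R.
(* The default value 1 of the minimum gives [eps <= 1]; the minimum is positive as it ranges over
   finitely many pairs. *)
exists (\big[Num.min/1%R]_(p | p.2 != p.1) e p)%R; last first.
  move=> h j jh; rewrite lerBrDl -lerBrDr.
  exact: (@bigmin_le_cond _ _ _ 1%R (h, j)).
rewrite bigmin_le_id andbT; apply: lt_bigmin => // -[h j] /= jh.
have [a [la kl]] := optimal_informative h j jh.
rewrite /e/= subr_gt0 -(lam_simplex h).2 (bigD1 a)//= [ltRHS](bigD1 a)//=.
apply: ltr_leD; first by rewrite gtr_pMr// aff_lt1.
by apply: ler_sum => b _; rewrite ler_piMr ?aff_le1// (lam_simplex h).1.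
Qed.

End Separation.

(* If [m] is the true state, every term shrinks; otherwise the term of [m] does,
   and it is the largest of the at most [H] terms. *)
Lemma root_odds_contraction (eps : R) t m rho : (0 < eps <= 1)%R ->
  (forall h j, j != h -> \sum_(a < A) lam h a * aff a h j <= 1 - eps)%R ->
  belief rho -> (forall j, rho j <= rho m)%R ->
  (\sum_(a < A) lam m a *
     (\sum_(j < H | j != t) Num.sqrt (rho j / rho t) * aff a t j) <=
   (1 - eps / H%:R) * root_odds t rho)%R.
Proof.
move=> /andP[e0 e1] sep b rm.
have H1 : (1 <= H%:R :> R)%R by rewrite ler1n (leq_ltn_trans _ (ltn_ord t)).
have H0 : (0 < H%:R :> R)%R by apply: lt_le_trans H1.
set r := fun j => Num.sqrt (rho j / rho t)%R.
have r0 j : (0 <= r j)%R by exact: sqrtr_ge0.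
have -> : (\sum_(a < A) lam m a * (\sum_(j < H | j != t) r j * aff a t j) =
  \sum_(j < H | j != t) r j * \sum_(a < A) lam m a * aff a t j)%R.
  under eq_bigr do rewrite mulr_sumr.
  rewrite exchange_big; apply: eq_bigr => j _; rewrite mulr_sumr.
  by apply: eq_bigr => a _; rewrite mulrCA.
have [mt|mt] := eqVneq m t.
  rewrite /root_odds -/r mulr_sumr; apply: ler_sum => j jt; rewrite mulrC.
  apply: ler_wpM2r => //; rewrite mt; apply: (le_trans (sep _ _ jt)).
  by rewrite lerD2l lerN2 ler_pdivrMr// ler_peMr// ltW.
have le1 j : (\sum_(a < A) lam m a * aff a t j <= 1)%R.
  rewrite -(lam_simplex m).2; apply: ler_sum => a _.
  by rewrite ler_piMr ?aff_le1// (lam_simplex m).1.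
have rmax : (root_odds t rho <= r m * H%:R)%R.
  apply: (@le_trans _ _ (\sum_(j < H) r m)%R).
    rewrite [leRHS](bigID (fun j => j != t))/=; apply: ler_wpDr; first exact: sumr_ge0.
    apply: ler_sum => j _; apply: ler_wsqrtr.
    by rewrite ler_pM2r ?invr_gt0 ?b.1.
  by rewrite sumr_const card_ord mulr_natr.
(* The mixture [lam m] separates [m] from [t]; the symmetry of the affinity, which the divergence
   lacks, turns this into a statement about the true state [t]. *)
have sepm : (\sum_(a < A) lam m a * aff a t m <= 1 - eps)%R.
  under eq_bigr do rewrite affinityC.
  by apply: sep; rewrite eq_sym.
apply: (@le_trans _ _ (root_odds t rho - eps * r m)%R); last first.
  rewrite mulrBl mul1r lerD2l lerN2 mulrAC ler_pdivrMr// -mulrA.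
  by apply: ler_wpM2l => //; exact: ltW.
rewrite /root_odds -/r (bigD1 m)//= [in leRHS](bigD1 m)//= addrAC; apply: lerD.
  by rewrite -[X in (X - _)%R]mulr1 [X in (_ - X)%R]mulrC -mulrBr ler_wpM2l.
by apply: ler_sum => j _; rewrite ler_piMr.
Qed.

Lemma integral_linear_comb (al : R) (w : 'I_H -> R) (P : pred 'I_H)
    (p : X -> R) (g : 'I_H -> X -> R) :
  (0 <= al)%R -> (forall j, 0 <= w j)%R ->
  measurable_fun setT p -> (forall j, measurable_fun setT (g j)) ->
  (forall x, 0 <= p x)%R -> (forall j x, 0 <= g j x)%R ->
  \int[mu]_x (al * p x + \sum_(j | P j) w j * g j x)%:E =
  al%:E * \int[mu]_x (p x)%:E + \sum_(j | P j) (w j)%:E * \int[mu]_x (g j x)%:E.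
Proof.
move=> al0 w0 mp mg p0 g0.
transitivity (\int[mu]_x (al%:E * (p x)%:E +
    \sum_(j <- enum P) (w j)%:E * (g j x)%:E)).
  apply: eq_integral => x _; rewrite EFinD EFinM big_enum/= -sumEFin.
  by congr (_ + _); apply: eq_bigr => j _; rewrite EFinM.
have mwg j : measurable_fun setT (fun x => (w j)%:E * (g j x)%:E).
  by apply: measurable_funeM; exact/measurable_EFinP.
have wg0 j x : 0 <= (w j)%:E * (g j x)%:E by rewrite mule_ge0// lee_fin.
rewrite ge0_integralD; [|by []|by move=> x _; rewrite mule_ge0// lee_fin
  |by apply: measurable_funeM; exact/measurable_EFinP
  |by move=> x _; exact: sume_ge0|exact: emeasurable_sum].
rewrite ge0_integralZl_EFin; [|by []|by move=> x _; rewrite lee_fin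
  |exact/measurable_EFinP|by []].
rewrite ge0_integral_sum// big_enum/=; congr (_ + _); apply: eq_bigr => j _.
rewrite ge0_integralZl_EFin; [by []|by []|by move=> x _; rewrite lee_fin
  |exact/measurable_EFinP|exact: w0].
Qed.

End Policy.

(** * Expectations along the policy *)

Section Averages.
Context {R : realType} {n : nat} (w : 'I_n -> R).
Hypothesis w_simplex : in_simplex w.

Lemma average_cst (r : R) : \sum_(a < n) (w a)%:E * r%:E = r%:E.
Proof.
under eq_bigr do rewrite -EFinM.
by rewrite sumEFin -mulr_suml w_simplex.2 mul1r.
Qed.

Lemma average_le (F : 'I_n -> \bar R) (g : 'I_n -> R) :
  (forall a, F a <= (g a)%:E) ->
  \sum_(a < n) (w a)%:E * F a <= (\sum_(a < n) w a * g a)%:E.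
Proof.
move=> Fg; rewrite -sumEFin; apply: lee_sum => a _; rewrite EFinM.
by apply: lee_wpmul2l; rewrite ?lee_fin ?w_simplex.1.
Qed.

Lemma average_ge (F : 'I_n -> \bar R) (m r : R) : (forall a, 0 <= F a) ->
  (0 <= r)%R -> (forall a, m%:E <= F a + r%:E) ->
  m%:E <= \sum_(a < n) (w a)%:E * F a + r%:E.
Proof.
move=> F0 r0 mF; rewrite -[leLHS]average_cst -[X in _ + X]average_cst -big_split/=.
apply: lee_sum => a _; rewrite -ge0_muleDr ?lee_fin//.
by apply: lee_wpmul2l; rewrite ?lee_fin ?w_simplex.1.
Qed.

End Averages.

(** On each side of 0 the inverse is an exponential of a logarithm. *)
Lemma measurable_invr {R : realType} : measurable_fun setT (fun x : R => x^-1)%R.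
Proof.
have -> : (fun x : R => x^-1)%R = (fun x : R => if (0 < x)%R then expR (- ln x)
    else if (x < 0)%R then - expR (- ln (- x)) else 0%R)%R.
  apply/funext => x; case: ltgtP => [x0|x0|<-]; last by rewrite invr0.
  - by rewrite expRN lnK.
  - by rewrite expRN lnK ?posrE ?oppr_gt0// invrN opprK.
have mln : measurable_fun setT (fun x : R => expR (- ln x))%R.
  by apply: measurableT_comp => //; apply: measurableT_comp.
apply: measurable_fun_ifT => //; first exact: measurable_fun_ltr.
apply: measurable_fun_ifT => //; first exact: measurable_fun_ltr.
apply: measurableT_comp => //.
exact: (measurableT_comp mln).
Qed.

Lemma measurable_forallb {d : measure_display} {Y : measurableType d} (I : finType)
    (b : I -> Y -> bool) : (forall i, measurable_fun setT (b i)) ->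
  measurable_fun setT (fun y => [forall i, b i y]).
Proof.
move=> mb; apply: (measurable_fun_bool true); rewrite setTI.
rewrite (_ : (_ @^-1` _)%classic = (\bigcap_(i in setT) (b i @^-1` [set true]))%classic).
  apply: fin_bigcap_measurable => // i _.
  by rewrite -[X in measurable X]setTI; exact: mb.
apply/seteqP; split=> [y /= /forallP by0 i _|y /= by0]; first exact: by0.
by apply/forallP => i; exact: by0.
Qed.

(* Measurability along every measurable family of vectors, so that no
   sigma-algebra on ['I_H -> R] is needed. *)
Definition belief_measurable {R : realType} {H : nat} (C : ('I_H -> R) -> \bar R) :=
  forall d (Y : measurableType d) (r : Y -> 'I_H -> R),
  (forall i, measurable_fun setT (fun y => r y i)) ->
  measurable_fun setT (fun y => C (r y)).

(** The expected [root_odds t] after one step with action [a] under true state [t]. *)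
Definition drift {R : realType} {d : measure_display} {X : measurableType d}
    {H A : nat} (mu : {measure set X -> \bar R}) (f : 'I_A -> 'I_H -> X -> R)
    (a : 'I_A) (t : 'I_H) (rho : 'I_H -> R) : R :=
  (\sum_(j < H | j != t) Num.sqrt (rho j / rho t) * affinity mu (f a t) (f a j))%R.

Section Dynamics.
Context {R : realType} {d : measure_display} {X : measurableType d}.
Context {H A : nat} {mu : {measure set X -> \bar R}} {f : 'I_A -> 'I_H -> X -> R}.
Context {c : 'I_A -> R} {lam : 'I_H -> 'I_A -> R} {amax : ('I_H -> R) -> 'I_H}.
Hypotheses (mf : forall a h, measurable_fun setT (f a h)).
Hypotheses (f0 : forall a h x, (0 <= f a h x)%R).
Hypotheses (f1 : forall a h, \int[mu]_x (f a h x)%:E = 1).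
Hypothesis c0 : forall a, (0 < c a)%R.
Hypothesis lam_simplex : forall h, in_simplex (lam h).
Hypothesis support : forall a,
  {ae mu, forall x, (forall h, f a h x = 0%R) \/ (forall h, (0 < f a h x)%R)}.

Let mfE a h : measurable_fun setT (fun x => (f a h x)%:E).
Proof. exact/measurable_EFinP. Qed.

Hypothesis amaxP : forall rho : 'I_H -> R,
  (forall j, (rho j <= rho (amax rho))%R) /\
  (forall j, rho j = rho (amax rho) -> (amax rho <= j)%N).

(** Breaking ties towards the smallest index turns [amax (r y) = k] into finitely many inequalities
    between coordinates. *)
Let measurable_amax {d'} {Y : measurableType d'} (r : Y -> 'I_H -> R) k :
  (forall i, measurable_fun setT (fun y => r y i)) ->
  measurable_fun setT (fun y => amax (r y) == k).
Proof.
move=> mr.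
have -> : (fun y => amax (r y) == k) = (fun y => [forall j,
    (r y j <= r y k)%R && ((r y k <= r y j)%R ==> (k <= j)%N)]).
  apply/funext => y; have [am ties] := amaxP (r y).
  apply/eqP/forallP => [<- j|kP].
    rewrite am/=; apply/implyP => le; apply: ties; apply/eqP.
    by rewrite eq_le am.
  have /andP[_] := kP (amax (r y)); rewrite am/= => kam.
  have e : r y k = r y (amax (r y)).
    by apply/eqP; rewrite eq_le am; have /andP[->] := kP (amax (r y)).
  by apply/val_inj/eqP; rewrite eqn_leq kam ties.
apply: measurable_forallb => j; apply: measurable_and.
  exact: measurable_fun_ler.
case: (k <= j)%N.
  by rewrite (_ : (fun _ => _) = cst true)//; apply/funext => y; rewrite implybT.
rewrite (_ : (fun _ => _) = (fun y => ~~ (r y k <= r y j)%R)).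
  by apply: measurable_neg; exact: measurable_fun_ler.
by apply/funext => y; rewrite implybF.
Qed.

Let measurable_stopped delta {d'} {Y : measurableType d'} (r : Y -> 'I_H -> R) :
  (forall i, measurable_fun setT (fun y => r y i)) ->
  measurable_fun setT (fun y => stopped delta (r y)).
Proof.
move=> mr; rewrite (_ : (fun y => _) =
    (fun y => ~~ [forall i, ~~ (1 - delta < r y i)%R])).
  apply: measurable_neg; apply: measurable_forallb => i.
  by apply: measurable_neg; exact: measurable_fun_ltr.
by apply/funext => y; rewrite negb_forall; apply: eq_existsb => i; rewrite negbK.
Qed.

Let measurable_update a {d'} {Y : measurableType d'} (r : Y -> 'I_H -> R) (g : Y -> X) :
  (forall i, measurable_fun setT (fun y => r y i)) -> measurable_fun setT g ->
  forall i, measurable_fun setT (fun y => update f (r y) a (g y) i).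
Proof.
move=> mr mg i.
have mfg j : measurable_fun setT (fun y => f a j (g y)) by exact: measurableT_comp.
rewrite /update; apply: measurable_funM; first exact: measurable_funM.
apply: (measurableT_comp measurable_invr); apply: measurable_sum => j.
exact: measurable_funM.
Qed.

Let measurable_bool_fun {d'} {Y : measurableType d'} (b : Y -> bool) :
  measurable_fun setT b -> measurable_fun setT (fun y => (b y)%:R : R).
Proof.
move=> mb; rewrite (_ : (fun y => _) = (fun y => if b y then 1%R else 0%R)).
  exact: measurable_fun_ifT.
by apply/funext => y; case: (b y).
Qed.

(** The common shape of both recursions: [K] is the value on stopping and [e] the price of a
    step. *)
Let measurable_step delta (K : ('I_H -> R) -> \bar R)
    (e : 'I_A -> R) t (C : ('I_H -> R) -> \bar R) :
  (forall a, 0 <= e a)%R -> (forall rho, 0 <= C rho) ->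
  belief_measurable K -> belief_measurable C ->
  belief_measurable (fun rho => if stopped delta rho then K rho else
    \sum_(a < A) (lam (amax rho) a)%:E *
      ((e a)%:E + \int[mu]_x ((f a t x)%:E * C (update f rho a x)))).
Proof.
move=> e0 C0 mK mC d' Y r mr; apply: measurable_fun_ifT.
- exact: measurable_stopped.
- exact: mK.
apply: emeasurable_sum => a; apply: emeasurable_funM.
  rewrite (_ : (fun y => _) =
      (fun y => (\sum_(k < H) lam k a * (amax (r y) == k)%:R)%:E)).
    apply/measurable_EFinP; apply: measurable_sum => k; apply: measurable_funM => //.
    by apply: measurable_bool_fun; exact: measurable_amax.
  apply/funext => y; congr EFin; rewrite (bigD1 (amax (r y)))//= eqxx mulr1.
  rewrite big1 ?addr0// => k /negbTE kn.
  by rewrite eq_sym kn mulr0.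
apply: emeasurable_funD => //.
apply: (measurable_fun_integral_density mu (f a t) (mf a t) (f0 a t) _
  (fun z : Y * X => C (update f (r z.1) a z.2))) => //.
- by rewrite f1 ltry.
- apply: mC; apply: measurable_update; last exact: measurable_snd.
  by move=> i; exact: measurableT_comp (mr i) measurable_fst.
Qed.

Lemma correct_within_ge0 delta t n rho : 0 <= correct_within mu f amax lam delta t n rho.
Proof.
elim: n rho => [|n IH] rho /=; case: ifP => // _; rewrite ?lee_fin//.
apply: sume_ge0 => a _; apply: mule_ge0; first by rewrite lee_fin (lam_simplex _).1.
by apply: integral_ge0 => x _; rewrite mule_ge0// lee_fin.
Qed.

Lemma cost_within_ge0 delta t n rho : 0 <= cost_within mu f amax lam c delta t n rho.
Proof.
elim: n rho => [|n IH] rho /=; case: ifP => // _.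
apply: sume_ge0 => a _; apply: mule_ge0; first by rewrite lee_fin (lam_simplex _).1.
rewrite adde_ge0 ?lee_fin ?(ltW (c0 _))//.
by apply: integral_ge0 => x _; rewrite mule_ge0// lee_fin.
Qed.

Lemma measurable_correct_within delta t n :
  belief_measurable (correct_within mu f amax lam delta t n).
Proof.
have mK : belief_measurable (fun rho => (amax rho == t)%:R%:E : \bar R).
  move=> d' Y r mr; apply/measurable_EFinP; apply: measurable_bool_fun.
  exact: measurable_amax.
elim: n => [|n IH] d' Y r mr /=.
  by apply: measurable_fun_ifT => //; [exact: measurable_stopped|exact: mK].
have := measurable_step delta _ (fun=> 0%R) t _ (fun=> lexx _)
  (correct_within_ge0 delta t n) mK IH _ _ r mr.
by congr measurable_fun; apply/funext => y; under [in RHS]eq_bigr do rewrite -[X in _ * X]add0e.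
Qed.

Lemma measurable_cost_within delta t n :
  belief_measurable (cost_within mu f amax lam c delta t n).
Proof.
elim: n => [|n IH] d' Y r mr /=.
  by apply: measurable_fun_ifT => //; exact: measurable_stopped.
apply: (measurable_step delta (fun=> 0) c t _ _ (cost_within_ge0 delta t n)) => //.
by move=> a; exact: ltW.
Qed.

(** The product of the true density and [al + be * root_odds] of the updated posterior, written
    without quotients; the two agree where all densities are positive. *)
Let majorant (al be : R) a t (rho : 'I_H -> R) (x : X) : R :=
  (al * f a t x + \sum_(j < H | j != t) be * Num.sqrt (rho j / rho t) *
     Num.sqrt (f a t x * f a j x))%R.

Let majorant_ge0 al be a t rho x : (0 <= al)%R -> (0 <= be)%R ->
  (0 <= majorant al be a t rho x)%R.
Proof.
move=> al0 be0; rewrite addr_ge0 ?mulr_ge0//.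
by apply: sumr_ge0 => j _; rewrite !mulr_ge0.
Qed.

Let measurable_majorant al be a t rho : measurable_fun setT (majorant al be a t rho).
Proof.
apply: measurable_funD; first exact: measurable_funM.
rewrite (_ : (fun x => _) = (fun x => \sum_(j <- enum (fun j => j != t))
    be * Num.sqrt (rho j / rho t) * Num.sqrt (f a t x * f a j x))%R); last first.
  by apply/funext => x; rewrite big_enum.
apply: measurable_sum => j; apply: measurable_funM => //.
exact: measurable_sqrt_mul.
Qed.

Let integral_majorant al be a t rho : (0 <= al)%R -> (0 <= be)%R ->
  \int[mu]_x (majorant al be a t rho x)%:E = (al + be * drift mu f a t rho)%:E.
Proof.
move=> al0 be0; rewrite /majorant.
rewrite (integral_linear_comb al (fun j => be * Num.sqrt (rho j / rho t))%R
  (fun j => j != t) (f a t) (fun j x => Num.sqrt (f a t x * f a j x))) //.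
- rewrite f1 mule1 EFinD /drift mulr_sumr -sumEFin; congr (_ + _).
  apply: eq_bigr => j _; rewrite (integral_sqrt_mul mu)//.
  by rewrite -EFinM mulrA.
- by move=> j; rewrite mulr_ge0.
- by move=> j; exact: measurable_sqrt_mul.
Qed.

Let majorantE al be a t rho x : (forall h, (0 < f a h x)%R) -> belief rho ->
  majorant al be a t rho x = (f a t x * (al + be * root_odds t (update f rho a x)))%R.
Proof.
move=> fx b; rewrite mulrDr [in RHS]mulrCA root_odds_update// mulr_sumr /majorant.
rewrite [X in (X + _)%R]mulrC; congr (_ + _)%R.
by apply: eq_bigr => j _; rewrite mulrA.
Qed.

Let measurable_predict a t rho (C : ('I_H -> R) -> \bar R) : belief_measurable C ->
  measurable_fun setT (fun x => (f a t x)%:E * C (update f rho a x)).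
Proof.
move=> mC; apply: emeasurable_funM => //; apply: mC.
exact: (measurable_update a (fun=> rho) id).
Qed.

(** A bound affine in [root_odds] passes through one step: almost everywhere the densities all
    vanish or the update is again a belief. *)
Lemma predict_upper (C : ('I_H -> R) -> \bar R) (al be : R) a t rho :
  (0 <= al)%R -> (0 <= be)%R -> (forall rho', 0 <= C rho') -> belief_measurable C ->
  (forall rho', belief rho' -> C rho' <= (al + be * root_odds t rho')%:E) ->
  belief rho ->
  \int[mu]_x ((f a t x)%:E * C (update f rho a x)) <= (al + be * drift mu f a t rho)%:E.
Proof.
move=> al0 be0 C0 mC CV b; rewrite -integral_majorant//.
apply: ae_ge0_le_integral => //.
- by move=> x _; rewrite mule_ge0// lee_fin.
- exact: measurable_predict.
- by move=> x _; rewrite lee_fin majorant_ge0.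
- by apply/measurable_EFinP; exact: measurable_majorant.
apply: filterS (support a) => x [fx _|fx _].
  by rewrite fx mul0e lee_fin majorant_ge0.
rewrite majorantE// EFinM; apply: lee_wpmul2l; first by rewrite lee_fin.
by apply: CV; exact: belief_update.
Qed.

(** Here the true state is averaged over the posterior. By Bayes' rule [rho t * f a t x] is the
    evidence times the updated posterior, and the evidence integrates to 1. *)
Lemma predict_lower (C : 'I_H -> ('I_H -> R) -> \bar R) (m be : R) a rho :
  (0 <= m)%R -> (0 <= be)%R -> (forall t rho', 0 <= C t rho') ->
  (forall t, belief_measurable (C t)) ->
  (forall rho', belief rho' ->
     m%:E <= \sum_(t < H) (rho' t)%:E * (C t rho' + (be * root_odds t rho')%:E)) ->
  belief rho ->
  m%:E <= \sum_(t < H) (rho t)%:E *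
    (\int[mu]_x ((f a t x)%:E * C t (update f rho a x)) + (be * drift mu f a t rho)%:E).
Proof.
move=> m0 be0 C0 mC mCV b.
pose F t x := (f a t x)%:E * C t (update f rho a x) + (majorant 0 be a t rho x)%:E.
have r0 t : (0 <= rho t)%R by exact: ltW (b.1 t).
have P0 t x : 0 <= (f a t x)%:E * C t (update f rho a x) by rewrite mule_ge0// lee_fin.
have F0 t x : 0 <= F t x by rewrite adde_ge0// lee_fin majorant_ge0.
have mM t : measurable_fun setT (fun x => (majorant 0 be a t rho x)%:E).
  by apply/measurable_EFinP; exact: measurable_majorant.
have mF t : measurable_fun setT (F t).
  by apply: emeasurable_funD => //; exact: measurable_predict.
have -> : \sum_(t < H) (rho t)%:E *
    (\int[mu]_x ((f a t x)%:E * C t (update f rho a x)) + (be * drift mu f a t rho)%:E) =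
    \int[mu]_x (\sum_(t < H) (rho t)%:E * F t x).
  rewrite ge0_integral_sum//.
  - apply: eq_bigr => t _; rewrite ge0_integralZl_EFin//; congr (_ * _).
    rewrite /F ge0_integralD//; last 2 first.
    + exact: measurable_predict.
    + by move=> x _; rewrite lee_fin majorant_ge0.
    by rewrite integral_majorant// add0r.
  - by move=> t; exact: measurable_funeM.
  - by move=> t x _; rewrite mule_ge0// lee_fin.
have -> : m%:E = \int[mu]_x (m%:E * \sum_(t < H) (rho t)%:E * (f a t x)%:E).
  rewrite ge0_integralZl_EFin//; last 2 first.
  - by move=> x _; apply: sume_ge0 => t _; rewrite mule_ge0// lee_fin.
  - by apply: emeasurable_sum => t; exact: measurable_funeM.
  rewrite ge0_integral_sum//; last 2 first.
  - by move=> t; exact: measurable_funeM.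
  - by move=> t x _; rewrite mule_ge0// lee_fin.
  under eq_bigr.
    move=> t _; rewrite ge0_integralZl_EFin//; last by move=> x _; rewrite lee_fin.
    rewrite f1 mule1; over.
  by rewrite sumEFin b.2 mule1.
apply: ae_ge0_le_integral => //.
- move=> x _; apply: mule_ge0 => //; apply: sume_ge0 => t _.
  by rewrite mule_ge0// lee_fin.
- by apply: measurable_funeM; apply: emeasurable_sum => t; exact: measurable_funeM.
- by move=> x _; apply: sume_ge0 => t _; rewrite mule_ge0// lee_fin.
- by apply: emeasurable_sum => t; exact: measurable_funeM.
apply: filterS (support a) => x [fx _|fx _].
  rewrite big1 ?mule0; last by move=> t _; rewrite fx mule0.
  by apply: sume_ge0 => t _; rewrite mule_ge0// lee_fin.
have s0 : (0 < \sum_(h < H) rho h * f a h x)%R by exact: (evidence_gt0 f).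
have sE : \sum_(t < H) (rho t)%:E * (f a t x)%:E =
    (\sum_(h < H) rho h * f a h x)%:E by rewrite -sumEFin.
rewrite sE; set s := (\sum_(h < H) _)%R in s0 *.
have b' := belief_update f a x rho fx b.
have -> : \sum_(t < H) (rho t)%:E * F t x = s%:E * \sum_(t < H)
    (update f rho a x t)%:E * (C t (update f rho a x) +
      (be * root_odds t (update f rho a x))%:E).
  rewrite ge0_sume_distrr; last first.
    move=> t _; rewrite mule_ge0 ?lee_fin ?(ltW (b'.1 t))// adde_ge0// lee_fin.
    by rewrite mulr_ge0// root_odds_ge0.
  apply: eq_bigr => t _; rewrite muleA -EFinM.
  have -> : (s * update f rho a x t = rho t * f a t x)%R.
    by rewrite /update -/s mulrC divfK// gt_eqF.
  rewrite EFinM -muleA; congr (_ * _); rewrite /F majorantE// add0r EFinM.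
  by rewrite ge0_muleDr// lee_fin mulr_ge0// root_odds_ge0.
rewrite muleC; apply: lee_wpmul2l; first by rewrite lee_fin ltW.
exact: mCV.
Qed.

(** * Lower bound on the cost from the growth of the log-odds *)

Section LowerDrift.
Context {B : R}.
Hypothesis logB : forall a i j,
  \int[mu]_x (f a i x * `|log2 (f a i x / f a j x)|)%:E <= B%:E.

Let B0 (a : 'I_A) (t : 'I_H) : (0 <= B)%R.
Proof.
rewrite -lee_fin; apply: le_trans (logB a t t); apply: integral_ge0 => x _.
by rewrite lee_fin mulr_ge0.
Qed.

(** One step adds at most [H * B] to the expected [log_odds]. The slack stands on the right, which
    avoids subtraction in the extended reals. *)
Lemma predict_log_lower (C : ('I_H -> R) -> \bar R) (m al ka : R) a t rho :
  (0 <= m)%R -> (0 <= al)%R -> (0 <= ka)%R -> (forall rho', 0 <= C rho') ->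
  belief_measurable C ->
  (forall rho', belief rho' -> m%:E <= C rho' + (al + ka * log_odds t rho')%:E) ->
  belief rho ->
  m%:E <= \int[mu]_x ((f a t x)%:E * C (update f rho a x)) +
    (al + ka * (log_odds t rho + H%:R * B))%:E.
Proof.
move=> m0 al0 ka0 C0 mC mCL b.
pose g j x := (f a t x * `|log2 (f a t x / f a j x)|)%R.
have g0 j x : (0 <= g j x)%R by rewrite mulr_ge0.
have mg j : measurable_fun setT (g j).
  apply: measurable_funM => //; apply: measurableT_comp => //.
  exact: measurable_log_ratio.
have lo0 := log_odds_ge0 t rho.
pose M x := ((al + ka * log_odds t rho) * f a t x + \sum_(j < H | j != t) ka * g j x)%R.
have M0 x : (0 <= M x)%R.
  by rewrite addr_ge0 ?mulr_ge0 ?addr_ge0 ?mulr_ge0// sumr_ge0// => j _; rewrite mulr_ge0.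
have mM : measurable_fun setT M.
  apply: measurable_funD; first exact: measurable_funM.
  rewrite (_ : (fun x => _) = (fun x => \sum_(j <- enum (fun j => j != t)) ka * g j x)%R).
    by apply: measurable_sum => j; exact: measurable_funM.
  by apply/funext => x; rewrite big_enum.
have IM : \int[mu]_x (M x)%:E <= (al + ka * (log_odds t rho + H%:R * B))%:E.
  rewrite /M (integral_linear_comb _ (fun=> ka) (fun j => j != t) (f a t) g)//; last first.
    by rewrite addr_ge0 ?mulr_ge0.
  rewrite f1 mule1 mulrDr addrA [leRHS]EFinD leeD2l//.
  apply: (@le_trans _ _ (\sum_(j < H) (ka * B)%:E)); last first.
    by rewrite sumEFin sumr_const card_ord lee_fin -[leLHS]mulr_natl [leLHS]mulrCA.
  apply: (@le_trans _ _ (\sum_(j < H | j != t) (ka * B)%:E)); last first.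
    rewrite [leRHS](bigID (fun j => j != t))/= leeDl//.
    by apply: sume_ge0 => j _; rewrite lee_fin mulr_ge0// (B0 a t).
  apply: lee_sum => j _; rewrite EFinM; apply: lee_wpmul2l; rewrite ?lee_fin//.
  exact: logB.
apply: le_trans (leeD2l _ IM).
have P0 x : 0 <= (f a t x)%:E * C (update f rho a x) by rewrite mule_ge0// lee_fin.
rewrite -ge0_integralD//; [|exact: measurable_predict|by move=> x _; rewrite lee_fin
  |exact/measurable_EFinP].
have -> : m%:E = \int[mu]_x (m%:E * (f a t x)%:E).
  by rewrite ge0_integralZl_EFin ?f1 ?mule1// => x _; rewrite lee_fin.
apply: ae_ge0_le_integral => //.
- by move=> x _; rewrite mule_ge0// lee_fin.
- exact: measurable_funeM.
- by move=> x _; rewrite adde_ge0// lee_fin.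
- apply: emeasurable_funD; first exact: measurable_predict.
  exact/measurable_EFinP.
apply: filterS (support a) => x [fx _|fx _].
  by rewrite fx mule0 adde_ge0// ?mul0e// lee_fin.
have b' := belief_update f a x rho fx b; set rho' := update f rho a x in b' *.
rewrite muleC; apply: (@le_trans _ _ ((f a t x)%:E *
    (C rho' + (al + ka * log_odds t rho')%:E))).
  by apply: lee_wpmul2l; [rewrite lee_fin|exact: mCL].
rewrite ge0_muleDr//; last by rewrite lee_fin addr_ge0 ?mulr_ge0 ?log_odds_ge0.
apply: leeD2l; rewrite -EFinM lee_fin /M /g.
have -> : (\sum_(j < H | j != t) ka * (f a t x * `|log2 (f a t x / f a j x)|) =
    ka * f a t x * \sum_(j < H | j != t) `|log2 (f a t x / f a j x)|)%R.
  by rewrite mulr_sumr; apply: eq_bigr => j _; rewrite mulrA.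
have lo := log_odds_update f a x rho fx b t; rewrite -/rho' -subr_ge0 in lo.
have p0 := mulr_ge0 (mulr_ge0 ka0 (f0 a t x)) lo; rewrite -subr_ge0.
apply: (le_trans p0).
by rewrite le_eqVlt; apply/orP; left; apply/eqP; ring.
Qed.

(** A Markov bound by induction: stopping within [n] steps requires [log_odds] to reach [L], whereas
    its mean is at most its initial value plus [n * (H * B)]. The correction term pays for the steps
    lost by stopping early. *)
Lemma cost_within_lower (cm L delta : R) t n rho :
  (0 < cm)%R -> (forall a, cm <= c a)%R -> (0 < L)%R ->
  (forall rho', belief rho' -> stopped delta rho' -> L <= log_odds t rho')%R ->
  belief rho ->
  (cm * n%:R)%:E <= cost_within mu f amax lam c delta t n rho +
    (cm * n%:R * (log_odds t rho + n%:R * (H%:R * B)) / L)%:E.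
Proof.
move=> cm0 cmc L0 stopL; elim: n rho => [|n IH] rho b.
  rewrite mulr0 mul0r mul0r adde0; exact: cost_within_ge0.
have lo0 := log_odds_ge0 t rho.
have [a0|a0] := posnP A.
  have [_] := lam_simplex t; rewrite big1 => [/eqP|a _]; first by rewrite eq_sym oner_eq0.
  by have aA := ltn_ord a; have := leq_ltn_trans (leq0n _) aA; rewrite [X in (_ < X)%N]a0.
have B0' : (0 <= B)%R := B0 (Ordinal a0) t.
have H0 : (0 <= H%:R :> R)%R by exact: ler0n.
have n0 : (0 <= n%:R :> R)%R by exact: ler0n.
have r0 : (0 <= cm * n.+1%:R * (log_odds t rho + n.+1%:R * (H%:R * B)) / L)%R.
  by rewrite !mulr_ge0 ?invr_ge0 ?addr_ge0 ?mulr_ge0// ltW.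
rewrite /=; case: ifPn => st.
  rewrite add0e lee_fin ler_pdivlMr//; apply: ler_wpM2l.
    by rewrite mulr_ge0// ltW.
  apply: (le_trans (stopL _ b st)).
  by rewrite lerDl !mulr_ge0.
apply: average_ge => // a.
  rewrite adde_ge0 ?lee_fin ?(ltW (c0 _))// integral_ge0// => x _.
  by rewrite mule_ge0 ?lee_fin// cost_within_ge0.
have cm0' := ltW cm0; have L0' : (0 <= L^-1)%R by rewrite invr_ge0 ltW.
set al := (cm * n%:R * (n%:R * (H%:R * B)) / L)%R.
set ka := (cm * n%:R / L)%R.
have mC rho' : belief rho' -> (cm * n%:R)%:E <=
    cost_within mu f amax lam c delta t n rho' + (al + ka * log_odds t rho')%:E.
  move=> b'; have := IH rho' b'; rewrite (_ : _ / L = al + ka * log_odds t rho')%R//.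
  by rewrite /al /ka; ring.
have := @predict_log_lower _ (cm * n%:R) al ka a t rho _ _ _
  (cost_within_ge0 delta t n) (measurable_cost_within delta t n) mC b.
rewrite /al /ka !mulr_ge0// => /(_ isT isT isT).
set I := \int[mu]_x _ => IHn.
(* The growth by [H * B] and the loss of one remaining step cancel inside the parenthesis, so only
   the factor [n] differs from [n.+1]. *)
have lin : (al + ka * (log_odds t rho + H%:R * B) <=
    cm * n.+1%:R * (log_odds t rho + n.+1%:R * (H%:R * B)) / L)%R.
  rewrite -subr_ge0 (_ : _ - _ = cm * (log_odds t rho + n.+1%:R * (H%:R * B)) / L)%R.
    by rewrite !mulr_ge0// addr_ge0// !mulr_ge0.
  by rewrite /al /ka -natr1; ring.
rewrite [X in X%:E <= _](_ : _ = cm + cm * n%:R)%R; last by rewrite -natr1; ring.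
rewrite EFinD -addeA; apply: leeD; first by rewrite lee_fin.
by apply: (le_trans IHn); apply: leeD2l; rewrite lee_fin; exact: lin.
Qed.

End LowerDrift.

(** * Cost and error bounds from the contraction of the root-odds *)

Section UpperDrift.
Context {gam : R}.
Hypotheses (gam0 : (0 <= gam)%R) (gam1 : (gam < 1)%R).
Hypothesis contraction : forall rho t, belief rho ->
  (\sum_(a < A) lam (amax rho) a * drift mu f a t rho <= gam * root_odds t rho)%R.

(* The right-hand side is, for varying [u], the family of tangents to
   [v |-> b * (1 + ln (v / sqrt delta))] at [v = u * sqrt delta]; being linear in
   [root_odds], it integrates without Jensen's inequality. *)
Lemma cost_within_upper (cM delta u : R) t n rho :
  (0 < delta)%R -> (forall a, c a <= cM)%R -> (0 < cM)%R -> (1 <= u)%R -> belief rho ->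
  cost_within mu f amax lam c delta t n rho <=
  (cM / (1 - gam) * (ln u + root_odds t rho / (Num.sqrt delta * u)))%:E.
Proof.
move=> d0 cMc cM0 u1 b.
have rhs_ge0 v rho' : (1 <= v)%R ->
    (0 <= cM / (1 - gam) * (ln v + root_odds t rho' / (Num.sqrt delta * v)))%R.
  move=> v1; apply: mulr_ge0; first by apply: divr_ge0; [exact: ltW|rewrite subr_ge0 ltW].
  apply: addr_ge0; first exact: ln_ge0.
  apply: divr_ge0; first exact: root_odds_ge0.
  by rewrite mulr_ge0 ?sqrtr_ge0// (le_trans _ v1).
elim: n rho b u u1 => [|n IH] rho b u u1.
  by rewrite /= if_same lee_fin rhs_ge0.
have u0 : (0 < u)%R by rewrite (lt_le_trans _ u1).
have g0 : (0 < 1 - gam)%R by rewrite subr_gt0.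
rewrite /=; case: ifPn => st.
  by rewrite lee_fin rhs_ge0.
have sV := sqrt_delta_le_root_odds _ t _ d0 b st.
set V := root_odds t rho in sV *.
set s := Num.sqrt delta in sV *; have s0 : (0 < s)%R by rewrite sqrtr_gt0.
have V0' : (0 < V)%R := lt_le_trans s0 sV.
set bb := (cM / (1 - gam))%R; have bb0 : (0 < bb)%R by rewrite divr_gt0.
(* The induction hypothesis will be used at [u = V / s], the tangent at the current value; this is
   allowed because [V >= s] before stopping. *)
have v1 : (1 <= V / s)%R by rewrite ler_pdivlMr// mul1r.
have lnv0 : (0 <= ln (V / s))%R by rewrite ln_ge0.
pose g a := (c a + (bb * ln (V / s) + bb / V * drift mu f a t rho))%R.
apply: (@le_trans _ _ (\sum_(a < A) lam (amax rho) a * g a)%:E).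
  apply: average_le => // a; rewrite /g EFinD leeD2l//.
  apply: predict_upper => //.
  - by rewrite mulr_ge0// ltW.
  - by rewrite divr_ge0 ?ltW.
  - exact: cost_within_ge0.
  - exact: measurable_cost_within.
  move=> rho' b'; apply: (le_trans (IH rho' b' _ v1)).
  rewrite lee_fin mulrDr lerD2l mulrCA mulrC -!mulrA (_ : s * (V / s) = V)%R//.
  by field; rewrite gt_eqF.
rewrite lee_fin /g.
apply: (@le_trans _ _ (cM + bb * ln (V / s) +
    bb / V * \sum_(a < A) lam (amax rho) a * drift mu f a t rho)%R).
  apply: (@le_trans _ _ (\sum_(a < A) (lam (amax rho) a * (cM + bb * ln (V / s)) +
      bb / V * (lam (amax rho) a * drift mu f a t rho)))%R); last first.
    by rewrite big_split/= -mulr_suml (lam_simplex _).2 mul1r -mulr_sumr.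
  apply: ler_sum => a _; rewrite [X in (_ <= _ + X)%R]mulrCA -mulrDr.
  apply: ler_wpM2l; first exact: (lam_simplex _).1.
  by rewrite addrA lerD2r lerD2r.
apply: (@le_trans _ _ (cM + bb * ln (V / s) + bb / V * (gam * V))%R).
  by rewrite lerD2l; apply: ler_wpM2l; [rewrite divr_ge0 ?ltW|exact: contraction].
(* Since [bb * (1 - gam) = cM], the contraction pays exactly for the step. *)
have -> : (cM + bb * ln (V / s) + bb / V * (gam * V) = bb * (1 + ln (V / s)))%R.
  by rewrite /bb; field; rewrite !gt_eqF.
apply: ler_wpM2l; first exact: ltW.
(* It remains to show [1 + ln w <= w] for [w = V / (s * u)]: every tangent lies above the
   logarithm. *)
have w0 : (0 < V / (s * u))%R by rewrite divr_gt0// mulr_gt0.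
have -> : (V / s = u * (V / (s * u)))%R by field; rewrite !gt_eqF.
rewrite lnM ?posrE// addrCA lerD2l.
have := @le_ln1Dx R (V / (s * u) - 1).
rewrite ltrBrDr addNr w0 => /(_ isT).
by rewrite addrCA subrr addr0 => le; rewrite addrC -lerBrDr.
Qed.

(** The term with [gam ^+ n] bounds the probability of not having stopped; on stopping, the declared
    hypothesis has posterior above [1 - delta]. *)
Lemma correct_within_lower (delta : R) n rho : (0 < delta < 1)%R -> belief rho ->
  (1 - delta)%:E <= \sum_(t < H) (rho t)%:E *
    (correct_within mu f amax lam delta t n rho +
      (gam ^+ n / Num.sqrt delta * root_odds t rho)%:E).
Proof.
move=> /andP[d0 d1]; have s0 : (0 < Num.sqrt delta)%R by rewrite sqrtr_gt0.
have stop rho' m : belief rho' -> stopped delta rho' ->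
    (1 - delta)%:E <= \sum_(t < H) (rho' t)%:E *
    ((amax rho' == t)%:R%:E + (gam ^+ m / Num.sqrt delta * root_odds t rho')%:E).
  move=> b /existsP[i ri]; have r0 t : (0 <= rho' t)%R by exact: ltW (b.1 t).
  rewrite (bigD1 (amax rho'))//= eqxx; apply: (@le_trans _ _ (rho' (amax rho'))%:E).
    by rewrite lee_fin (le_trans (ltW ri))// (amaxP rho').1.
  have V0 t : (0 <= gam ^+ m / Num.sqrt delta * root_odds t rho')%R.
    by rewrite !mulr_ge0 ?exprn_ge0 ?invr_ge0 ?(ltW s0)// root_odds_ge0.
  rewrite -[leLHS]adde0; apply: leeD.
    by rewrite -EFinD -EFinM lee_fin ler_peMr// lerDl.
  apply: sume_ge0 => t _; apply: mule_ge0; first by rewrite lee_fin.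
  by rewrite adde_ge0 ?lee_fin.
elim: n rho => [|n IH] rho b.
  have [st|st] := boolP (stopped delta rho); first by rewrite /= st; exact: stop.
  rewrite /= (negbTE st).
  (* With no step left and no stopping, the correction is at least 1, as [root_odds] is at least
     [sqrt delta]. *)
  apply: (@le_trans _ _ (\sum_(t < H) (rho t *
      (gam ^+ 0 / Num.sqrt delta * root_odds t rho))%:E)); last first.
    by apply: lee_sum => t _; rewrite add0e EFinM.
  rewrite sumEFin lee_fin expr0; apply: (@le_trans _ _ (\sum_(t < H) rho t)%R).
    by rewrite b.2 gerBl ltW.
  apply: ler_sum => t _; rewrite ler_peMr//; first exact: ltW (b.1 t).
  by rewrite div1r mulrC ler_pdivlMr// mul1r sqrt_delta_le_root_odds.
have r0 t : (0 <= rho t)%R by exact: ltW (b.1 t).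
have [st|st] := boolP (stopped delta rho); first by rewrite /= st; exact: stop.
rewrite /= (negbTE st).
set ka := (gam ^+ n / Num.sqrt delta)%R.
have ka0 : (0 <= ka)%R by rewrite divr_ge0 ?exprn_ge0// ltW.
pose I a t := \int[mu]_x ((f a t x)%:E *
  correct_within mu f amax lam delta t n (update f rho a x)).
have I0 a t : 0 <= I a t.
  by apply: integral_ge0 => x _; rewrite mule_ge0 ?lee_fin// correct_within_ge0.
have dr0 a t : (0 <= drift mu f a t rho)%R.
  by apply: sumr_ge0 => j _; rewrite mulr_ge0// affinity_ge0.
have la a : (0 <= lam (amax rho) a)%R by exact: (lam_simplex _).1.
have IHa a : (1 - delta)%:E <=
    \sum_(t < H) (rho t)%:E * (I a t + (ka * drift mu f a t rho)%:E).
  apply: (predict_lower (fun t => correct_within mu f amax lam delta t n)) => //.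
  - by rewrite subr_ge0 ltW.
  - by move=> t; exact: correct_within_ge0.
  - by move=> t; exact: measurable_correct_within.
apply: (@le_trans _ _ (\sum_(a < A) (lam (amax rho) a)%:E *
    \sum_(t < H) (rho t)%:E * (I a t + (ka * drift mu f a t rho)%:E))).
  rewrite -[leLHS](average_cst (lam (amax rho)) (lam_simplex _)).
  by apply: lee_sum => a _; apply: lee_wpmul2l; rewrite ?lee_fin.
have T0 a t : 0 <= (rho t)%:E * (I a t + (ka * drift mu f a t rho)%:E).
  by rewrite mule_ge0 ?lee_fin// adde_ge0// lee_fin mulr_ge0.
have dist a : (lam (amax rho) a)%:E *
    \sum_(t < H) (rho t)%:E * (I a t + (ka * drift mu f a t rho)%:E) =
    \sum_(t < H) (rho t)%:E * ((lam (amax rho) a)%:E * I a t +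
      (lam (amax rho) a * (ka * drift mu f a t rho))%:E).
  rewrite ge0_sume_distrr//; apply: eq_bigr => t _; rewrite muleCA; congr (_ * _).
  by rewrite EFinM ge0_muleDr// lee_fin mulr_ge0.
rewrite (eq_bigr _ (fun a _ => dist a)).
rewrite exchange_big/=; apply: lee_sum => t _.
rewrite -ge0_sume_distrr; last first.
  move=> a _; apply: adde_ge0; first by rewrite mule_ge0// lee_fin.
  by rewrite lee_fin; apply: mulr_ge0 => //; exact: mulr_ge0.
apply: lee_wpmul2l; first by rewrite lee_fin.
rewrite big_split/=; apply: leeD2l.
rewrite sumEFin lee_fin exprS (_ : gam * gam ^+ n / _ * _ = ka * (gam * root_odds t rho))%R.
  under eq_bigr do rewrite mulrCA.
  by rewrite -mulr_sumr; apply: ler_wpM2l => //; exact: contraction.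
by rewrite /ka; ring.
Qed.

End UpperDrift.

End Dynamics.

(** * Rates and the theorem *)

Section Rates.
Import numFieldNormedType.Exports.
Context {R : realType}.
Local Open Scope ring_scope.

Lemma exists_geometric_lt (g e : R) : 0 <= g < 1 -> 0 < e -> exists n, g ^+ n < e.
Proof.
move=> /andP[g0 g1] e0.
have /cvgr0_norm_lt /(_ e e0) [N _ HN] : ((fun n => g ^+ n) @ \oo --> (0 : R))%classic.
  by apply: cvg_expr; rewrite ger0_norm.
exists N; have := HN N (leqnn N); rewrite /= ger0_norm//.
exact: exprn_ge0.
Qed.

(** The integer part of [L / (2 * K)], which is at least 1, so that rounding down costs at most a
    factor 2. *)
Lemma exists_horizon (K L : R) : 0 < K -> 2 * K <= L ->
  exists n : nat, n%:R * K <= L / 2 /\ L <= 4 * K * n%:R.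
Proof.
move=> K0 KL; set x := L / (2 * K).
have x1 : 1 <= x by rewrite ler_pdivlMr ?mul1r// mulr_gt0.
have LE : L = x * (2 * K) by rewrite /x divfK// gt_eqF// mulr_gt0.
have /andP[nx xn] := truncn_itv (le_trans ler01 x1).
have n1 : 1 <= (Num.truncn x)%:R :> R by rewrite ler1n truncn_gt0.
exists (Num.truncn x); rewrite LE -natr1 in xn *; split; nra.
Qed.

Lemma log2_odds_ge (delta : R) : 0 < delta <= 2^-1 ->
  log2 delta^-1 - 1 <= log2 ((1 - delta) / delta).
Proof.
move=> /andP[d0 d1].
have -> : log2 delta^-1 - 1 = log2 (2^-1 / delta).
  rewrite log2M ?invr_gt0// [log2 2^-1]log2V// /log2 divff ?gt_eqF ?ln2_gt0//.
  by rewrite addrC.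
apply: ler_log2; first by rewrite divr_gt0// invr_gt0.
by rewrite ler_pM2r ?invr_gt0//; lra.
Qed.

Lemma log2_gt_of_lt (M delta : R) : 0 < delta -> delta < expR (- (M * ln 2)) ->
  M < log2 delta^-1.
Proof.
move=> d0 dM; rewrite /log2 ltr_pdivlMr ?ln2_gt0// lnV ?posrE//.
by rewrite ltrNr -(expRK (- _)) ltr_ln ?posrE// expR_gt0.
Qed.

(** The correction consumes at most half of [cm * n]; the other half suffices because
    [l <= 2 * L <= 8 * K * n]. *)
Lemma horizon_rate (cm K L l : R) (n : nat) : 0 < cm -> 0 < K -> 0 < L ->
  n%:R * K <= L / 2 -> L <= 4 * K * n%:R -> l <= 2 * L ->
  cm / (16 * K) * l + cm * n%:R * (n%:R * K) / L <= cm * n%:R.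
Proof.
move=> cm0 K0 L0 n1 n2 lL; have n0 : 0 <= n%:R :> R by exact: ler0n.
have half : n%:R * K / L <= 2^-1 by rewrite ler_pdivrMr// [leRHS]mulrC.
have q : l / (16 * K) <= n%:R / 2 by rewrite ler_pdivrMr ?mulr_gt0//; lra.
rewrite (_ : _ + _ = cm * (l / (16 * K) + n%:R * (n%:R * K / L))); last by ring.
apply: ler_wpM2l; first exact: ltW.
have := ler_wpM2l n0 half; lra.
Qed.

End Rates.

Theorem theorem1 (R : realType) (d : measure_display) (X : measurableType d)
  (H A : nat) (mu : {measure set X -> \bar R})
  (f : 'I_A -> 'I_H -> X -> R) (c : 'I_A -> R)
  (amax : ('I_H -> R) -> 'I_H) (lam : 'I_H -> 'I_A -> R) :
  (* densities w.r.t. mu *)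
  (forall a h, measurable_fun setT (f a h)) ->
  (forall a h x, (0 <= f a h x)%R) ->
  (forall a h, \int[mu]_x (f a h x)%:E = 1) ->
  (* positive costs *)
  (forall a, (0 < c a)%R) ->
  (* (A1) *)
  (forall a i j, KL mu f a i j = 0 \/ 0 < KL mu f a i j) ->
  (* (A2) *)
  (forall i j : 'I_H, i != j -> exists a, 0 < KL mu f a i j) ->
  ~ (exists a, forall i j, KL mu f a i j = 0) ->
  (* (A3) *)
  (exists beta : R, (0 < beta)%R /\
     forall a i j, llr_sq_moment mu f a i j < beta%:E) ->
  (* lambda*_h in the argmax over the simplex *)
  (forall h, in_simplex (lam h) /\
     forall l, in_simplex l -> objective mu f c h l <= objective mu f c h (lam h)) ->
  (* h*_n = argmax_h rho_{n-1}[h] (ties broken towards the smallest index) *)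
  (forall rho : 'I_H -> R,
     (forall j, (rho j <= rho (amax rho))%R) /\
     (forall j, rho j = rho (amax rho) -> (amax rho <= j)%N)) ->
  (forall delta : R, (0 < delta < 1)%R ->
     error_prob mu f amax lam delta <= delta%:E)
  /\
  (exists c1 c2 delta0 : R, (0 < c1)%R /\ (0 < c2)%R /\ (0 < delta0)%R /\
     forall delta : R, (0 < delta < delta0)%R ->
       (c1 * log2 (delta^-1))%:E <= expected_cost mu f amax lam c delta /\
       expected_cost mu f amax lam c delta <= (c2 * log2 (delta^-1))%:E).
Proof.
move=> mf f0 f1 c0 A1 A2 A2' [beta [beta0 A3]] opt amaxP.
have simplex h : in_simplex (lam h) := (opt h).1.
have H0 : (0 < H)%N := leq_ltn_trans (leq0n _) (ltn_ord (amax (fun=> 0%R))).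
have HR0 : (0 < H%:R :> R)%R by rewrite ltr0n.
have A0 : (0 < A)%N := actions_gt0 simplex (amax (fun=> 0%R)).
have support a : {ae mu, forall x,
    (forall h, f a h x = 0%R) \/ (forall h, (0 < f a h x)%R)}.
  by apply: ae_common_support => // i j; rewrite (lt_trans (A3 a i j))// ltry.
(* With a single hypothesis all divergences would vanish, against the second part of (A2). *)
have other t : exists t', t' != t :> 'I_H.
  apply: contrapT => no; apply: A2'; exists (Ordinal A0) => i j.
  have eq_t k : k = t by apply/eqP/negPn/negP => kt; apply: no; exists k.
  by apply: KL_eq0 => //; rewrite (eq_t i) (eq_t j); apply: aeW.
have KL0 a i j : 0 <= KL mu f a i j by case: (A1 a i j) => [->|/ltW].
have [eps /andP[e0 e1] sep] := exists_separation mf f0 f1 c0 simplex KL0 A2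
  (fun h => (opt h).2).
set gam := (1 - eps / H%:R)%R.
have gam0 : (0 <= gam)%R.
  by rewrite subr_ge0 ler_pdivrMr// mul1r (le_trans e1)// ler1n.
have gam1 : (gam < 1)%R by rewrite gtrBl divr_gt0.
have contraction rho t : belief rho ->
    (\sum_(a < A) lam (amax rho) a * drift mu f a t rho <= gam * root_odds t rho)%R.
  move=> b; apply: root_odds_contraction => //; first by rewrite e0.
  by move=> j; exact: (amaxP rho).1.
have b0 : belief (@uniform_prior R H) by exact: belief_uniform.
have prior_simplex : in_simplex (@uniform_prior R H).
  by split=> [i|]; [exact: ltW (b0.1 i)|exact: b0.2].
split=> [delta d01|].
  have [d0 d1] := andP d01; have s0 : (0 < Num.sqrt delta)%R by rewrite sqrtr_gt0.
  rewrite /error_prob; set S := ereal_sup _.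
  suff : (1 - delta)%:E <= S.
    case: S => [s| |] //=; last by move=> _; exact: leNye.
    by rewrite -EFinB !lee_fin => ?; lra.
  apply/lee_addgt0Pr => e e00.
  (* At the prior [root_odds] is at most [H], so this [n] brings the correction below [e]. *)
  have [n gn] := exists_geometric_lt gam (e * Num.sqrt delta / H%:R)
    (introT andP (conj gam0 gam1)) (divr_gt0 (mulr_gt0 e00 s0) HR0).
  apply: (le_trans (correct_within_lower mf f0 f1 simplex support amaxP gam0
    contraction delta n _ d01 b0)).
  apply: (@le_trans _ _ (\sum_(t < H) (uniform_prior t)%:E *
      (correct_within mu f amax lam delta t n (@uniform_prior R H) + e%:E))).
    apply: lee_sum => t _; apply: lee_wpmul2l; first by rewrite lee_fin (ltW (b0.1 t)).
    apply: leeD2l; rewrite lee_fin.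
    apply: (@le_trans _ _ (gam ^+ n / Num.sqrt delta * H%:R)%R).
      apply: ler_wpM2l; last exact: root_odds_uniform.
      by rewrite divr_ge0 ?exprn_ge0// ltW.
    by rewrite mulrAC ler_pdivrMr// -ler_pdivlMr// ltW.
  under eq_bigr.
    move=> t _; rewrite ge0_muleDr ?lee_fin ?(ltW e00)//; last exact: correct_within_ge0.
    over.
  rewrite big_split/= average_cst//; apply: leeD2r.
  by apply: ereal_sup_ubound; exists n.
pose cm := (\big[Num.min/1]_a c a)%R.
have cm0 : (0 < cm)%R by exact: lt_bigmin.
have cmc a : (cm <= c a)%R by exact: bigmin_le.
pose cM := (\sum_a c a)%R.
have cMc a : (c a <= cM)%R.
  by rewrite /cM (bigD1 a)//= lerDl sumr_ge0// => i _; exact: ltW.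
have cM0 : (0 < cM)%R by exact: lt_le_trans (c0 (Ordinal A0)) (cMc _).
pose K := (H%:R * (1 + beta))%R.
have K0 : (0 < K)%R by rewrite mulr_gt0// addr_gt0.
have bb0 : (0 < cM / (1 - gam))%R by rewrite divr_gt0// subr_gt0.
have lnH0 : (0 <= ln (H%:R : R))%R by rewrite ln_ge0// ler1n.
have ln20 := @ln2_gt0 R.
(* With [L = log2 ((1 - delta) / delta) >= l - 1], the bound [l > M] gives [L > 0], [l <= 2 * L] and
   [2 * K <= L]; moreover [M >= 1] gives [delta <= 1 / 2]. *)
pose M := (2 + 2 * K)%R.
exists (cm / (16 * K))%R, (cM / (1 - gam) * (1 + ln H%:R + ln 2))%R, (expR (- (M * ln 2)))%R.
split; first by rewrite divr_gt0// mulr_gt0.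
split; first by rewrite mulr_gt0// addr_gt0// ltr_pwDl.
split; first exact: expR_gt0.
move=> delta /andP[d0 dM]; have lM := log2_gt_of_lt M delta d0 dM.
set l := log2 delta^-1 in lM *.
have d2 : (delta <= 2^-1)%R.
  apply: (le_trans (ltW dM)).
  have <- : (expR (- ln 2) = 2^-1 :> R)%R by rewrite expRN lnK// posrE.
  by rewrite ler_expR lerN2 ler_peMl ?(ltW ln20)// /M; lra.
have d1 : (delta < 1)%R by lra.
split; last first.
  apply: ge_ereal_sup => _ [n _ <-].
  have s0 : (0 < Num.sqrt delta)%R by rewrite sqrtr_gt0.
  have dsd : (delta <= Num.sqrt delta)%R.
    rewrite -{1}(sqr_sqrtr (ltW d0)) expr2 ler_piMr ?(ltW s0)//.
    by rewrite -sqrtr1 ler_wsqrtr// ltW.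
  set rhs := (_ * l)%R.
  suff cost_le t : cost_within mu f amax lam c delta t n (@uniform_prior R H) <= rhs%:E.
    apply: (le_trans (average_le _ prior_simplex _ (fun=> rhs) cost_le)).
    by rewrite -mulr_suml prior_simplex.2 mul1r.
  (* For this [u] the product [sqrt delta * u] is [H], which bounds the initial [root_odds]; only
     [ln u] then grows as [delta] tends to 0. *)
  have u1 : (1 <= H%:R / Num.sqrt delta)%R.
    rewrite ler_pdivlMr// mul1r (@le_trans _ _ 1%R) ?ler1n//.
    by rewrite -[leRHS]sqrtr1 ler_wsqrtr// ltW.
  apply: (le_trans (cost_within_upper mf f0 f1 c0 simplex support amaxP gam1
    contraction cM delta _ t n _ d0 cMc cM0 u1 b0)).
  rewrite lee_fin /rhs -[leRHS]mulrA; apply: ler_wpM2l; first exact: ltW.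
  have V1 : (root_odds t (@uniform_prior R H) /
      (Num.sqrt delta * (H%:R / Num.sqrt delta)) <= 1)%R.
    have -> : (Num.sqrt delta * (H%:R / Num.sqrt delta) = H%:R)%R.
      by rewrite mulrC divfK// gt_eqF.
    rewrite ler_pdivrMr// mul1r.
    exact: root_odds_uniform.
  have lnu : (ln (H%:R / Num.sqrt delta) <= ln H%:R + ln 2 * l)%R.
    rewrite ln_div ?posrE// lerD2l -lnV ?posrE// /l /log2 mulrC divfK ?gt_eqF//.
    by rewrite ler_ln ?posrE ?invr_gt0// lef_pV2 ?posrE.
  have l1 : (1 <= l)%R by apply: le_trans (ltW lM); rewrite /M; lra.
  apply: (le_trans (lerD lnu V1)); nra.
have [L0 lL] : (0 < log2 ((1 - delta) / delta) /\ l <= 2 * log2 ((1 - delta) / delta))%R.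
  have := log2_odds_ge delta (introT andP (conj d0 d2)); rewrite -/l.
  by move: lM K0; rewrite /M => *; split; lra.
have KL2 : (2 * K <= log2 ((1 - delta) / delta))%R.
  have := log2_odds_ge delta (introT andP (conj d0 d2)); rewrite -/l.
  by move: lM K0; rewrite /M => *; lra.
have [n [n1 n2]] := exists_horizon K _ K0 KL2.
have rate := horizon_rate cm K _ l n cm0 K0 L0 n1 n2 lL.
apply: (@le_trans _ _ (\sum_(t < H) (uniform_prior t)%:E *
    cost_within mu f amax lam c delta t n (@uniform_prior R H))); last first.
  by apply: ereal_sup_ubound; exists n.
rewrite -[leLHS](average_cst (@uniform_prior R H) prior_simplex).
apply: lee_sum => t _; apply: lee_wpmul2l; first by rewrite lee_fin (ltW (b0.1 t)).
have [t' t't] := other t.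
have := @cost_within_lower _ _ _ _ _ _ _ _ _ _ mf f0 f1 c0 simplex support amaxP (1 + beta)
  (fun a i j => integral_abs_log_ratio mf f0 a i j beta (f1 a i) (A3 a i j))
  cm _ delta t n _ cm0 cmc L0
  (fun rho => log_odds_ge_of_stopped delta t t' rho (introT andP (conj d0 d1)) t't) b0.
(* All log-odds vanish at the prior, so the correction is the one in [rate] and cancels as a finite
   term. *)
rewrite log_odds_uniform add0r -/K => low.
by move: rate; rewrite -lee_fin EFinD => /le_trans/(_ low); rewrite leeD2rE.
Qed.
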